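(* For every $\alpha > 0$ there exists $\psi_0 > 0$ such that for every $0 < \psi \le \psi_0$ there exists $n_0 \in \mathbb{N}$ such that the following holds for every $n \ge n_0$. Let $H$ be a $3$-graph on $n$ vertices with $\delta_2(H) \ge (7/9 + \alpha)n$. Let $X \subseteq V(H)$ satisfy $|X| \le \psi n$. Let $s \le \psi n$ and let $\mathbf{x}_1, \mathbf{y}_1, \dots, \mathbf{x}_s, \mathbf{y}_s$ be pairwise vertex-disjoint ordered triples of vertices which are edges of $H \setminus X$. Then there exists a set $\mathscr{P} = \{P_1, \dots, P_s\}$ of pairwise vertex-disjoint squared-tight-paths in $H \setminus X$ such that for each $i \le s$ the path $P_i$ is from $\mathbf{x}_i$ to $\mathbf{y}_i$, and such that $|V(\mathscr{P})| \le \psi^{1/2} n$ and $V(\mathscr{P}) \cap X = \emptyset$.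
   Context: A $3$-graph $H$ consists of a finite vertex set $V(H)$ and a set $E(H)$ of $3$-element subsets of $V(H)$ (edges). The minimum codegree $\delta_2(H)$ is the largest $m$ such that every pair of distinct vertices of $H$ is contained in at least $m$ edges. $H \setminus X$ denotes the subgraph of $H$ induced on $V(H) \setminus X$. $K_4^3$ is the complete $3$-graph on four vertices. An ordered triple $(v_1,v_2,v_3)$ is said to be an edge of $H$ if $\{v_1,v_2,v_3\} \in E(H)$. A squared-tight-path in $H$ is a sequence $(v_1,\dots,v_\ell)$ of distinct vertices in which every set of four consecutive vertices forms a copy of $K_4^3$ in $H$; its initial triple is $(v_1,v_2,v_3)$ and its final triple is $(v_{\ell-2},v_{\ell-1},v_\ell)$, and it is from $\mathbf{u}$ to $\mathbf{v}$ if its initial triple is $\mathbf{u}$ and its final triple is $\mathbf{v}$ (as ordered triples). For a set $\mathscr{P}$ of squared-tight-paths, $V(\mathscr{P})$ denotes the union of their vertex sets. *)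

(* Defs.v *)
From mathcomp Require Import all_boot all_order all_algebra.
From mathcomp Require Import reals.

Set Implicit Arguments.
Unset Strict Implicit.
Unset Printing Implicit Defensive.

(* The vertex set is a subset of an ambient finite type, so that the induced
   subgraph H \ X is again a 3-graph over the same type. *)
Record graph3 (T : finType) := Graph3 {
  verts : {set T};
  edges : {set {set T}};
  edgesP : forall e, e \in edges -> (e \subset verts) && (#|e| == 3)
}.

Section Graph3.
Variable T : finType.
Implicit Types (H : graph3 T) (X A : {set T}) (u v : T) (t : 3.-tuple T).

Definition codegree H u v : nat :=
  #|[set e in edges H | (u \in e) && (v \in e)]|.

(* The bound m <= #|edges H| only makes the maximum finite: it holds for every
   admissible m as soon as H has two distinct vertices (see [leq_codegree]). *)
Definition min_codegree H : nat :=
  \max_(m < #|edges H|.+1 |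
        [forall u in verts H, forall v in verts H,
           (u != v) ==> (m <= codegree H u v)]) m.

Lemma leq_codegree H u v : codegree H u v <= #|edges H|.
Proof. by apply/subset_leq_card/subsetP => e; rewrite inE => /andP[]. Qed.

Lemma min_codegree_geP H m : 1 < #|verts H| ->
  reflect (forall u v, u \in verts H -> v \in verts H -> u != v ->
             m <= codegree H u v)
          (m <= min_codegree H).
Proof.
move=> V_gt1; apply: (iffP idP) => [le_m u v uH vH uv|h].
  apply: leq_trans le_m _; apply/bigmax_leqP => k.
  by move=> /forall_inP/(_ u uH)/forall_inP/(_ v vH)/implyP; apply.
have /card_gt1P[a [b [aH bH ab]]] := V_gt1.
have ltm : m < #|edges H|.+1.
  by rewrite ltnS (leq_trans (h a b aH bH ab)) ?leq_codegree.
apply: (@leq_bigmax_cond _ _ (fun k : 'I__ => k : nat) (Ordinal ltm)).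
by apply/forall_inP => u uH; apply/forall_inP => v vH; apply/implyP; apply: h.
Qed.

Lemma del_verts_subproof H X e :
  e \in [set e in edges H | e \subset verts H :\: X] ->
  (e \subset verts H :\: X) && (#|e| == 3).
Proof. by rewrite inE => /andP[/edgesP /andP[_ ->] ->]. Qed.

Definition del_verts H X : graph3 T := Graph3 (@del_verts_subproof H X).

Definition is_K43 H A : bool :=
  [&& A \subset verts H, #|A| == 4 &
      [forall e : {set T}, (e \subset A) && (#|e| == 3) ==> (e \in edges H)]].

Definition triple_edge H t : bool := [set z in t] \in edges H.

Definition squared_tight_path H (p : seq T) : Prop :=
  [/\ uniq p, {subset p <= verts H} &
      forall i, i + 4 <= size p -> is_K43 H [set z in take 4 (drop i p)]].

(* Since t1 and t2 have size 3, both equations force 3 <= size p. *)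
Definition path_from_to (p : seq T) (t1 t2 : 3.-tuple T) : Prop :=
  take 3 p = t1 /\ drop (size p - 3) p = t2.

Definition vertex_disjoint (p q : seq T) : bool := [disjoint p & q].

Definition family_verts (s : nat) (P : 'I_s -> seq T) : {set T} :=
  \bigcup_(i < s) [set z in P i].

End Graph3.

(* Main.v *)
Require Import Defs.
From mathcomp Require Import all_boot all_order all_algebra.
From mathcomp Require Import reals zify ring lra.
Set Implicit Arguments.
Unset Strict Implicit.
Unset Printing Implicit Defensive.
Import Order.TTheory GRing.Theory Num.Theory.

(** The [s] paths are chosen one after another ([greedy_disjoint]).  When a path
    is due, the vertices of [X], of the earlier paths and of the other triples
    form a set of at most [(K + 7) * psi * n <= alpha * n] vertices, provided
    each path has at most [K] vertices with [K] depending on [alpha] only.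
    Deleting that set leaves a 3-graph of relative codegree [7 / 9 + alpha / 2],
    so it suffices to join two disjoint ordered edges by a squared tight path of
    bounded length ([connecting_path]).

    Connectivity comes first.  Walk on ordered edges by [(a, b, c) -> (b, c, d)]
    whenever [abcd] spans a complete 3-graph.  If every pair of vertices has
    fewer than [2 n / 9] non-neighbours, any ordered edge can be reached from any
    other ([dense3_connected]), for two reasons.
    - The order of an edge does not matter.  A walk can turn a clique [abcd]
      cyclically for ever, so what counts is the cyclic order.  If a vertex [e]
      is joined to all pairs of [abcd] except perhaps [cd], then [c] and [d] can
      exchange their places by way of [e].  Counting non-neighbours provides
      enough such pairs to reach all cyclic orders ([root_K4_perm]).
    - All edges lie in one component.  Call the edges of one component red and
      the others blue, and colour the link graph of a vertex [a] accordingly.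
      If [bcx] is a triangle of this link with edges of both colours, then [abcx]
      is no clique, so [x] is one of the few non-neighbours of the pair [bc]:
      each link edge is in fewer than [2 n / 9] bichromatic triangles.  In such
      a link no vertex meets both colours ([link_monochromatic]); hence colours
      agree on edges sharing a pair, then on edges sharing a vertex, then
      everywhere.

    Bounded length comes from sampling.  A random map of [C] indices into the
    vertex set inherits the codegree condition with high probability, where [C]
    depends on [alpha] only; with positive probability its first six points also
    continue the first prescribed edge and lead into the second one
    ([many_good_samples]).  A sample contains a walk between these, of length at
    most [C ^ 3 + 3], but it may revisit points.  A positive proportion of all
    samples induce the same 3-graph on the indices, so they contain a complete
    blow-up of one of them ([complete_blowup]), and every visit to a point can
    use a fresh copy of it. *)

(** * Counting with ninths *)
Definition count_where (I : finType) (P : pred I) : nat := \sum_x P x.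

Lemma count_whereE (I : finType) (P : pred I) : count_where P = #|[set x | P x]|.
Proof. by rewrite -sum1dep_card big_mkcond. Qed.

Lemma eq_count_where (I : finType) (P Q : pred I) : P =1 Q -> count_where P = count_where Q.
Proof. by move=> PQ; apply: eq_bigr => x _; rewrite PQ. Qed.

Lemma sub_count_where (I : finType) (P Q : pred I) :
  (forall x, P x -> Q x) -> count_where P <= count_where Q.
Proof. by move=> PQ; apply: leq_sum => x _; case: (P x) (PQ x) => // ->. Qed.

Lemma count_whereC (I : finType) (P : pred I) :
  count_where P + count_where (fun x => ~~ P x) = #|I|.
Proof.
rewrite -sum1_card -big_split /=; apply: eq_bigr => x _.
by case: (P x).
Qed.

(** An entry [(c, P)] records that [P] has density below [c / 9]. *)
Fixpoint ninths_below (I : finType) (L : seq (nat * pred I)) : Prop :=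
  if L is (c, P) :: L' then 9 * count_where P < c * #|I| /\ ninths_below L' else True.

(** If every point belonged to at least [k] of the sets, their densities would
    add up to at least [k].  The lists used below are dual
    solutions of small linear programs whose variables are the proportions of
    vertices of each adjacency type; an entry listed twice has weight two. *)
Lemma ninths_below_witness (I : finType) (L : seq (nat * pred I)) k :
  ninths_below L -> 0 < size L -> sumn (unzip1 L) <= 9 * k ->
  exists x, count (fun cP : nat * pred I => cP.2 x) L < k.
Proof.
move=> small L0 le_k.
suff lt : \sum_x count (fun cP : nat * pred I => cP.2 x) L < \sum_(x : I) k.
  apply/existsP; apply: contraLR lt; rewrite negb_exists -leqNgt => /forallP le.
  by apply: leq_sum => x _; rewrite leqNgt.
have -> : \sum_(x : I) k = k * #|I| by rewrite big_const iter_addn_0.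
suff: 9 * \sum_x count (fun cP : nat * pred I => cP.2 x) L < sumn (unzip1 L) * #|I|.
  by move=> lt; rewrite -(ltn_pmul2l (isT : 0 < 9)) (leq_trans lt) // mulnA leq_mul2r le_k orbT.
elim: L L0 small {le_k} => //= -[c P] L IH _ [smallP smallL].
under eq_bigr do rewrite /=; rewrite big_split /= mulnDr mulnDl.
case: L IH smallL => [_ _|cP L IH smallL].
  rewrite [X in _ + 9 * X]big1 // !muln0 !addn0.
  exact: smallP.
by rewrite -addSn leq_add // ?(ltnW (IH _ _)) //.
Qed.

(** * Two-coloured link graphs *)
Section Link.
Variable I : finType.
Implicit Types (r b : rel I).
Local Notation n := #|I|.

Definition joined r b u x := r u x || b u x.
Definition off_color r b u v x :=
  [&& joined r b u x, joined r b v x & ~~ (r u x && r v x)].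

(** What the link of a vertex inherits from a 3-graph in which pairs have few
    non-neighbours and cliques are monochromatic: few non-neighbours, and every
    edge in few triangles that are not entirely of its colour. *)
Record link_coloring r b : Prop := LinkColoring {
  link_symr : symmetric r;
  link_symb : symmetric b;
  link_disj : forall x y, r x y -> b x y -> False;
  link_miss : forall u v, joined r b u v ->
    9 * count_where (fun x => ~~ joined r b u x) < 2 * n;
  link_offr : forall u v, r u v -> 9 * count_where (off_color r b u v) < 2 * n;
  link_offb : forall u v, b u v -> 9 * count_where (off_color b r u v) < 2 * n }.

Lemma link_coloringC r b : link_coloring r b -> link_coloring b r.
Proof.
case=> rC bC dis mi tr tb; split=> //.
- by move=> x y bxy rxy; apply: dis rxy bxy.
- move=> u v uv; have := mi u v; rewrite /joined orbC => /(_ uv).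
  by under eq_count_where => x do rewrite orbC.
Qed.

Lemma link_missr r b u v : link_coloring r b -> r u v ->
  9 * count_where (fun x => ~~ joined r b u x) < 2 * n.
Proof. by move=> L uv; apply: (link_miss L (v := v)); rewrite /joined uv. Qed.

Lemma link_missb r b u v : link_coloring r b -> b u v ->
  9 * count_where (fun x => ~~ joined r b u x) < 2 * n.
Proof. by move=> L uv; apply: (link_miss L (v := v)); rewrite /joined uv orbT. Qed.

Variant color_spec : bool -> bool -> Type :=
  | ColorRed : color_spec true false
  | ColorBlue : color_spec false true
  | ColorNone : color_spec false false.

Lemma colorP r b (dis : forall x y, r x y -> b x y -> False) x y :
  color_spec (r x y) (b x y).
Proof.
by move: (dis x y); case: (r x y); case: (b x y) => D; try constructor; case: D.
Qed.

(** A vertex that is not joined to [u] in red is a non-neighbour of [u] or of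
    [v], or forms a bichromatic triangle with [u] and [v]. *)
Lemma link_few_nonred r b u v : link_coloring r b -> r u v ->
  9 * count_where (fun x => ~~ r u x) < 6 * n.
Proof.
move=> L uv; have h1 := link_missr L uv.
have h2 : 9 * count_where (fun x => ~~ joined r b v x) < 2 * n.
  by apply: (link_missr L (v := u)); rewrite (link_symr L).
have h3 := link_offr L uv.
suff: count_where (fun x => ~~ r u x) <= count_where (off_color r b u v) +
  count_where (fun x => ~~ joined r b u x) + count_where (fun x => ~~ joined r b v x).
  by move: h1 h2 h3; clear; lia.
rewrite -!big_split /=; apply: leq_sum => x _.
rewrite /off_color /joined.
by case: (r u x); case: (b u x); case: (r v x); case: (b v x).
Qed.

(** Whatever the adjacency of a vertex to [u], [v], [w], it belongs to at
    least two of the seven sets listed, although their densities add up to less than two. *)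
Lemma link_triangle r b u v w x : link_coloring r b ->
  r u v -> b u w -> b v w -> r w x -> False.
Proof.
move=> L uv uw vw wx; have dis := link_disj L.
have [] := @ninths_below_witness I [:: (2, fun x => ~~ joined r b u x);
   (2, fun x => ~~ joined r b v x); (2, fun x => ~~ joined r b w x);
   (2, off_color r b u v); (2, off_color b r u w); (2, off_color b r v w);
   (6, fun x => ~~ r w x)] 2; rewrite //=.
  do !split; [exact: (link_missr L uv)|exact: (link_missb L vw)|exact: link_missr L wx
    |exact: (link_offr L uv)|exact: (link_offb L uw)|exact: (link_offb L vw)|exact: (link_few_nonred L wx)].
move=> y; rewrite /off_color /joined; clear -dis.
by case: (colorP dis u y); case: (colorP dis v y); case: (colorP dis w y).
Qed.

(** Only a common blue neighbour of [u] and [v] belongs to at most one of the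
    five sets listed. *)
Lemma link_common_blue r b u v x y : link_coloring r b ->
  r u v -> b u x -> b v y -> exists z, b u z && b v z.
Proof.
move=> L uv ux vy; have dis := link_disj L.
have [] := @ninths_below_witness I [:: (2, fun x => ~~ joined r b u x);
   (2, fun x => ~~ joined r b v x); (2, off_color r b u v);
   (6, fun x => ~~ b u x); (6, fun x => ~~ b v x)] 2; rewrite //=.
  do !split; [exact: (link_missr L uv)|exact: (link_missb L vy)|exact: (link_offr L uv)| |].
    exact: (link_few_nonred (link_coloringC L) ux).
  exact: (link_few_nonred (link_coloringC L) vy).
move=> z h; exists z; move: h; rewrite /off_color /joined; clear -dis.
by case: (colorP dis u z); case: (colorP dis v z).
Qed.

(** Vertices [m] and [m'] that see one colour each, not the same, force a
    configuration that cannot exist: averaging yields in turn vertices [v0],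
    [v1], [v2], [v3] of prescribed adjacency, as every other adjacency would
    belong to too many small sets, and then no adjacency is left at all for a
    further vertex. *)
Lemma link_not_mixed r b m m' x x' : link_coloring r b ->
  r m x -> (forall y, b m y = false) -> b m' x' -> (forall y, r m' y = false) -> False.
Proof.
move=> L mx mB m'x' m'R.
have rC := link_symr L; have bC := link_symb L; have dis := link_disj L.
have hm := link_missr L mx; have hm' := link_missb L m'x'.
have [v0 [mv0 m'v0]] : exists v, r m v /\ b m' v.
  have [] := @ninths_below_witness I [:: (2, fun x => ~~ joined r b m x);
     (2, fun x => ~~ joined r b m' x)] 1; rewrite //=.
  move=> v; rewrite /joined mB m'R orbF /= => h; exists v; move: h; clear.
  by case: (r m v); case: (b m' v).
have v0m : r v0 m by rewrite rC.
have v0m' : b v0 m' by rewrite bC.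
have h0 := link_missr L v0m; have t0 := link_offr L v0m; have t0' := link_offb L v0m'.
have [v1 [v0v1 mv1 m'v1]] : exists v, [/\ r v0 v, r m v & b m' v].
  have [] := @ninths_below_witness I [:: (2, fun x => ~~ joined r b m x);
     (2, fun x => ~~ joined r b m' x); (2, fun x => ~~ joined r b v0 x);
     (2, off_color r b v0 m)] 1; rewrite //=.
  move=> v; rewrite /off_color /joined mB m'R => h; exists v; move: h; clear -dis.
  by case: (colorP dis v0 v); case: (r m v); case: (b m' v).
have v1v0 : r v1 v0 by rewrite rC.
have h1 := link_missr L v1v0.
have t01 := link_offr L v0v1; have tm1 := link_offr L mv1; have tm1' := link_offb L m'v1.
have [v2 [v0v2 mv2 m'v2 v1v2]] : exists v, [/\ b v0 v, r m v, b m' v & ~~ joined r b v1 v].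
  have [] := @ninths_below_witness I [:: (2, fun x => ~~ joined r b m x);
     (2, fun x => ~~ joined r b m' x); (2, fun x => ~~ joined r b m' x);
     (2, fun x => ~~ joined r b v0 x); (2, fun x => ~~ joined r b v1 x);
     (2, off_color b r v0 m'); (2, off_color r b v0 v1); (2, off_color r b m v1);
     (2, off_color b r m' v1)] 2; rewrite //=.
  move=> v; rewrite /off_color /joined mB m'R => h; exists v; move: h; clear -dis.
  by case: (colorP dis v0 v); case: (colorP dis v1 v); case: (r m v); case: (b m' v).
have v2v0 : b v2 v0 by rewrite bC.
have h2 := link_missb L v2v0.
have t02 := link_offb L v0v2; have tm2 := link_offr L mv2.
have [v3 [mv3 m'v3 v1v3 v2v3]] : exists v, [/\ r m v, b m' v, b v1 v & r v2 v].
  have [] := @ninths_below_witness I [:: (2, fun x => ~~ joined r b m x);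
     (2, fun x => ~~ joined r b m' x); (2, fun x => ~~ joined r b v0 x);
     (2, fun x => ~~ joined r b v1 x); (2, fun x => ~~ joined r b v2 x);
     (2, off_color r b v0 v1); (2, off_color b r v0 v2); (2, off_color r b m v2);
     (2, off_color b r m' v1)] 2; rewrite //=.
  move=> v; rewrite /off_color /joined mB m'R => h; exists v; move: h; clear -dis.
  by case: (colorP dis v0 v); case: (colorP dis v1 v); case: (colorP dis v2 v);
    case: (r m v); case: (b m' v).
have v3v1 : b v3 v1 by rewrite bC.
have h3 := link_missb L v3v1; have t13 := link_offb L v1v3; have t23 := link_offr L v2v3.
have [] := @ninths_below_witness I [:: (2, fun x => ~~ joined r b v0 x);
   (2, fun x => ~~ joined r b v1 x); (2, fun x => ~~ joined r b v2 x);
   (2, fun x => ~~ joined r b v3 x); (2, off_color r b v0 v1); (2, off_color b r v0 v2);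
   (2, off_color b r v1 v3); (2, off_color r b v2 v3)] 2; rewrite //=.
move=> v; rewrite /off_color /joined; clear -dis.
by case: (colorP dis v0 v); case: (colorP dis v1 v); case: (colorP dis v2 v);
  case: (colorP dis v3 v).
Qed.

(** With [ro] replaced by its lower bound, the difference of the two sides is
    [(9 be - 3 n') (6 n' - 9 be) / 9 + 9 (q - be)^2]. *)
Lemma degree_tradeoff (K : realFieldType) (n' q be ro : K) :
  (3 * n' < 9 * be -> 9 * be < 6 * n' -> 7 * n' < 9 * ro + 9 * be -> 0 < q ->
   (n' - q) * (2 * n' + 9 * (q - be)) < ro * 9 * q)%R.
Proof.
move=> h1 h2 h3 h4.
have k1 : (0 <= (9 * be - 3 * n') * (6 * n' - 9 * be))%R.
  by apply: mulr_ge0; rewrite subr_ge0 ltW.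
have k2 : (0 <= (q - be) ^+ 2)%R by apply: sqr_ge0.
have k3 : (q * (7 * n' - 9 * be) < q * (9 * ro))%R by rewrite ltr_pM2l //; lra.
apply: (@le_lt_trans _ _ (q * (7 * n' - 9 * be))%R); last first.
  by rewrite (_ : ro * 9 * q = q * (9 * ro))%R //; ring.
rewrite -subr_ge0.
have -> : (q * (7 * n' - 9 * be) - (n' - q) * (2 * n' + 9 * (q - be)) =
  (9 * be - 3 * n') * (6 * n' - 9 * be) / 9 + 9 * (q - be) ^+ 2)%R by field.
by apply: addr_ge0; [apply: divr_ge0 | apply: mulr_ge0]; rewrite ?ler0n.
Qed.

(** Suppose every vertex that sees blue sees red, and let [Q] be the set of
    vertices that see both.  By the two preceding lemmas on triangles and common
    neighbours, [Q] spans no red edge, so blue lives inside [Q] and every edge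
    leaving [Q] is red.  If [u] in [Q] is joined to [o] outside, few neighbours
    of [o] are blue neighbours of [u], which bounds the degree [D o] of [o] into
    [Q].  Summing [1 / D o] over the edges between [Q] and its complement gives
    at most the size of the complement on one side, and by [degree_tradeoff]
    strictly more on the other. *)
Lemma link_no_pure_blue r b v x y : link_coloring r b ->
  (forall u w, b u w -> exists z, r u z) -> r v x -> b v y -> False.
Proof.
move=> L blue_red vx vy.
have rC := link_symr L; have bC := link_symb L; have dis := link_disj L.
pose Q := [set u | [exists w, b u w]].
have inQ u w : b u w -> u \in Q by move=> uw; rewrite inE; apply/existsP; exists w.
have Qblue u : u \in Q -> exists w, b u w by rewrite inE => /existsP.
have redQ u w : u \in Q -> r u w -> w \notin Q.
  move=> /Qblue[x1 ux1] uw; apply/negP => /Qblue[x2 wx2].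
  have [z /andP[uz wz]] := link_common_blue L uw ux1 wx2.
  have [z' zz'] : exists z', r z z' by apply: (blue_red z u); rewrite bC.
  exact: link_triangle L uw uz wz zz'.
pose rho u := count_where (r u); pose beta u := count_where (b u).
pose D o := \sum_(u in Q) r o u.
have q0 : 0 < #|Q| by apply/card_gt0P; exists v; apply: inQ vy.
have qn : #|Q| <= #|I| by apply: max_card.
have beta_q u : beta u <= #|Q|.
  rewrite /beta count_whereE; apply: subset_leq_card; apply/subsetP => w.
  by rewrite inE => uw; apply: (inQ w u); rewrite bC.
have degs u : u \in Q -> [/\ 3 * #|I| < 9 * beta u, 9 * beta u < 6 * #|I| &
   7 * #|I| < 9 * rho u + 9 * beta u].
  move=> uQ; have [w uw] := Qblue u uQ; have [z uz] := blue_red u w uw.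
  have h1 := link_few_nonred L uz; have h2 := link_few_nonred (link_coloringC L) uw.
  have h3 := link_missr L uz.
  have e1 := count_whereC (r u); have e2 := count_whereC (b u).
  have e3 : rho u + beta u + count_where (fun x => ~~ joined r b u x) = #|I|.
    rewrite -sum1_card -!big_split /=; apply: eq_bigr => t _; rewrite /joined.
    by case: (colorP dis u t).
  by move: h1 h2 h3 e1 e2 e3; rewrite /rho /beta; clear; simpl; split; lia.
have D_le u o : u \in Q -> r u o -> 9 * D o < 2 * #|I| + 9 * (#|Q| - beta u).
  move=> uQ uo; have h := link_offr L uo.
  suff: D o + beta u <= count_where (off_color r b u o) + #|Q|.
    by move: h (beta_q u); clear; lia.
  have -> : #|Q| = \sum_z (z \in Q) by rewrite -sum1_card big_mkcond.
  rewrite /D big_mkcond -!big_split /=; apply: leq_sum => z _.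
  have := inQ z u; rewrite bC /off_color /joined.
  case: (colorP dis u z); case: (colorP dis o z) => h'; rewrite ?(h' isT) //; by case: (z \in Q).
pose F o u : rat := ((r o u)%:R / (D o)%:R)%R.
have F_le o : (\sum_(u in Q) F o u <= 1)%R.
  rewrite -mulr_suml -natr_sum -/(D o); have [->|D0] := posnP (D o).
    by rewrite mul0r ler01.
  by rewrite divff // pnatr_eq0 -lt0n.
have F_ge u : u \in Q -> ((#|I|%:R - #|Q|%:R) / #|Q|%:R < \sum_(o in ~: Q) F o u)%R.
  move=> uQ; have [b3 b6 rb] := degs u uQ; have bq := beta_q u.
  pose M : rat := (2 * #|I|%:R + 9 * (#|Q|%:R - (beta u)%:R))%R.
  have ME : M = (2 * #|I| + 9 * (#|Q| - beta u))%:R%R by rewrite /M natrD !natrM natrB.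
  have M0 : (0 < M)%R by rewrite ME ltr0n; move: q0 qn; clear; lia.
  apply: (@lt_le_trans _ _ (\sum_(o in ~: Q) (r u o)%:R * (9 / M))%R); last first.
    apply: ler_sum => o _; rewrite /F (rC o u); case uo: (r u o); last by rewrite !mul0r.
    rewrite !mul1r; have D0 : 0 < D o.
      by rewrite /D (bigD1 u) //= rC uo.
    rewrite (ler_pdivrMr _ _ M0) mulrC (ler_pdivlMr _ _ _) ?ltr0n //.
    by rewrite ME -natrM ler_nat ltnW // D_le.
  rewrite -mulr_suml -natr_sum.
  have -> : \sum_(o in ~: Q) r u o = rho u.
    rewrite /rho /count_where [RHS](bigID (mem (~: Q))) /= [X in _ + X]big1 ?addn0 // => o.
    by rewrite inE negbK; case uo: (r u o) => //; rewrite (negPf (redQ u o uQ uo)).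
  rewrite ltr_pdivrMr ?ltr0n // mulrA mulrAC ltr_pdivlMr //.
  have r1 : (3 * #|I|%:R < 9 * (beta u)%:R :> rat)%R by rewrite -!natrM ltr_nat.
  have r2 : (9 * (beta u)%:R < 6 * #|I|%:R :> rat)%R by rewrite -!natrM ltr_nat.
  have r3 : (7 * #|I|%:R < 9 * (rho u)%:R + 9 * (beta u)%:R :> rat)%R.
    by rewrite -!natrM -natrD ltr_nat.
  have r4 : (0 < #|Q|%:R :> rat)%R by rewrite ltr0n.
    by rewrite /M; apply: degree_tradeoff.
suff : (#|I|%:R - #|Q|%:R < (#|I|%:R - #|Q|%:R :> rat))%R by rewrite ltxx.
apply: (@lt_le_trans _ _ (\sum_(u in Q) \sum_(o in ~: Q) F o u)%R).
  have -> : (#|I|%:R - #|Q|%:R = \sum_(u in Q) ((#|I|%:R - #|Q|%:R) / #|Q|%:R) :> rat)%R.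
    by rewrite sumr_const -[RHS]mulr_natr divfK // pnatr_eq0 -lt0n.
  rewrite [X in (_ < X)%R](bigD1 v) ?(inQ v y) //= [X in (X < _)%R](bigD1 v) ?(inQ v y) //=.
  apply: ltr_leD; first by apply: F_ge; apply: inQ vy.
  by apply: ler_sum => u /andP[uQ _]; apply: ltW; apply: F_ge.
rewrite exchange_big /=; apply: (@le_trans _ _ (\sum_(o in ~: Q) 1)%R).
  by apply: ler_sum => o _.
by rewrite sumr_const -natrB // cardsCs setCK.
Qed.

(** A vertex that sees only red and one that sees only blue cannot coexist, so
    the preceding lemma applies to one of the two colours. *)
Lemma link_monochromatic r b v x y : link_coloring r b -> r v x -> b v y -> False.
Proof.
move=> L vx vy.
have [/existsP[m /andP[/existsP[z mz] /negP mr]]|noblue] :=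
    boolP [exists m, [exists z, b m z] && ~~ [exists z, r m z]]; last first.
  apply: link_no_pure_blue L _ vx vy => u w uw.
  apply/existsP; apply: contraNT noblue => noz.
  by apply/existsP; exists u; rewrite noz andbT; apply/existsP; exists w.
have mR t : r m t = false by apply/negP => mt; apply: mr; apply/existsP; exists t.
apply: (link_no_pure_blue (link_coloringC L) _ vy vx) => u w uw.
apply/existsP; apply: contraT => ub.
have uB t : b u t = false by apply: contraNF ub => ut; apply/existsP; exists t.
by case: (link_not_mixed L uw uB mz mR).
Qed.
End Link.

(** * Connectivity of dense 3-graphs *)
Section Core.
Variable I : finType.
Implicit Types (E red : I -> I -> I -> bool).
Local Notation n := #|I|.

Record dense3 E : Prop := Dense3 {
  dense3_sym12 : forall x y z, E x y z = E y x z;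
  dense3_sym23 : forall x y z, E x y z = E x z y;
  dense3_irr : forall x y, E x x y = false;
  dense3_codeg : forall u v, u != v -> 9 * count_where (fun x => ~~ E u v x) < 2 * n }.

Definition K4 E a b c d := [&& E a b c, E a b d, E a c d & E b c d].

Lemma dense3_neq E u v w : dense3 E -> E u v w -> u != v.
Proof. by move=> D uvw; apply/eqP => uv; rewrite uv (dense3_irr D) in uvw. Qed.

Lemma dense3_neq3 E u v w : dense3 E -> E u v w -> [/\ u != v, u != w & v != w].
Proof.
move=> D uvw; split; first exact: dense3_neq uvw.
  by apply: (@dense3_neq E u w v D); rewrite (dense3_sym23 D).
by apply: (@dense3_neq E v w u D); rewrite (dense3_sym23 D) (dense3_sym12 D).
Qed.

Section Fixed.
Variables (E : I -> I -> I -> bool).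
Hypothesis D : dense3 E.
Let s12 := dense3_sym12 D.
Let s23 := dense3_sym23 D.

Lemma dense3_sym13 x y z : E x y z = E z y x.
Proof. by rewrite s12 s23 s12. Qed.
Lemma dense3_rot x y z : E x y z = E y z x.
Proof. by rewrite s12 s23. Qed.

Lemma K4_sym12 a b c d : K4 E a b c d = K4 E b a c d.
Proof. by rewrite /K4 (s12 b a) (s12 b a); case: (E a b c); case: (E a b d); rewrite //= andbC. Qed.
Lemma K4_sym23 a b c d : K4 E a b c d = K4 E a c b d.
Proof.
rewrite /K4 (s23 a c b) (s12 c b d).
by case: (E a b c) => //=; rewrite !andbA (andbC (E a b d)).
Qed.
Lemma K4_sym34 a b c d : K4 E a b c d = K4 E a b d c.
Proof.
rewrite /K4 (s23 a d c) (s23 b d c).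
by rewrite !andbA (andbC (E a b c)).
Qed.
Lemma K4_rot a b c d : K4 E a b c d = K4 E b c d a.
Proof. by rewrite K4_sym12 K4_sym23 K4_sym34. Qed.

Lemma edge_in_K4 a b c : E a b c -> exists d, K4 E a b c d.
Proof.
move=> abc; have [ab ac bc] := dense3_neq3 D abc.
have [] := @ninths_below_witness I [:: (2, fun x => ~~ E a b x);
  (2, fun x => ~~ E a c x); (2, fun x => ~~ E b c x)] 1; rewrite //=.
  by do !split; apply: (dense3_codeg D).
move=> d h; exists d; move: h; rewrite /K4 abc; clear.
by case: (E a b d); case: (E a c d); case: (E b c d).
Qed.

(** The vertex [e] is joined to all pairs of [x, y, z, w] except perhaps
    [x, y]. *)
Definition swappable x y z w := exists e, K4 E z w x e /\ K4 E z w y e.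

Ltac edge_tac := solve [ assumption | rewrite s12; assumption | rewrite s23; assumption
  | rewrite dense3_sym13; assumption | rewrite dense3_rot; assumption | rewrite dense3_rot dense3_rot; assumption ].
Ltac K4_tac := apply/and4P; split; edge_tac.

(** Pairs of the triangle [bcd] count twice and the three pairs at [a] once,
    total density below two: some [e] misses no pair of [bcd] and at most one
    pair at [a], and that pair can be swapped. *)
Lemma swappable_star a b c d : K4 E a b c d ->
  [\/ swappable a b c d, swappable a c b d | swappable a d b c].
Proof.
move=> K; case/and4P: (K) => abc abd acd bcd.
have [nab nac nbc] := dense3_neq3 D abc; have [_ nad nbd] := dense3_neq3 D abd.
have [_ _ ncd] := dense3_neq3 D acd.
have [] := @ninths_below_witness I [:: (2, fun x => ~~ E b c x); (2, fun x => ~~ E b c x);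
  (2, fun x => ~~ E b d x); (2, fun x => ~~ E b d x);
  (2, fun x => ~~ E c d x); (2, fun x => ~~ E c d x);
  (2, fun x => ~~ E a b x); (2, fun x => ~~ E a c x); (2, fun x => ~~ E a d x)] 2; rewrite //=.
  by do !split; apply: (dense3_codeg D).
move=> e h.
have [bce bde cde] : [/\ E b c e, E b d e & E c d e].
  by move: h; clear; case: (E b c e); case: (E b d e); case: (E c d e).
have : [|| E a c e && E a d e, E a b e && E a d e | E a b e && E a c e].
  by move: h; clear; case: (E b c e); case: (E b d e); case: (E c d e);
    case: (E a b e); case: (E a c e); case: (E a d e).
case/or3P => /andP[h1 h2]; [apply: Or31|apply: Or32|apply: Or33]; exists e; split; K4_tac.
Qed.

(** The same count, with the roles of the light pairs played by [ac], [ad] and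
    [bc], three of the four pairs between [ab] and [cd]. *)
Lemma swappable_cut a b c d : K4 E a b c d ->
  [\/ swappable a c b d, swappable a d b c | swappable b c a d].
Proof.
move=> K; case/and4P: (K) => abc abd acd bcd.
have [nab nac nbc] := dense3_neq3 D abc; have [_ nad nbd] := dense3_neq3 D abd.
have [_ _ ncd] := dense3_neq3 D acd.
have [] := @ninths_below_witness I [:: (2, fun x => ~~ E a b x); (2, fun x => ~~ E a b x);
  (2, fun x => ~~ E b d x); (2, fun x => ~~ E b d x);
  (2, fun x => ~~ E c d x); (2, fun x => ~~ E c d x);
  (2, fun x => ~~ E b c x); (2, fun x => ~~ E a c x); (2, fun x => ~~ E a d x)] 2; rewrite //=.
  by do !split; apply: (dense3_codeg D).
move=> e h.
have [abe bde cde] : [/\ E a b e, E b d e & E c d e].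
  by move: h; clear; case: (E a b e); case: (E b d e); case: (E c d e).
have : [|| E a d e && E b c e, E a c e && E b c e | E a c e && E a d e].
  by move: h; clear; case: (E a b e); case: (E b d e); case: (E c d e);
    case: (E b c e); case: (E a c e); case: (E a d e).
case/or3P => /andP[h1 h2]; [apply: Or31|apply: Or32|apply: Or33]; exists e; split; K4_tac.
Qed.

Definition walk_step (s t : I * I * I) : bool :=
  [&& t.1.1 == s.1.2, t.1.2 == s.2 & K4 E s.1.1 s.1.2 s.2 t.2].

Lemma K4_walk_step a b c d : K4 E a b c d -> walk_step (a, b, c) (b, c, d).
Proof. by move=> K; rewrite /walk_step /= !eqxx. Qed.

(** Three more turns around the clique lead back. *)
Lemma walk_step_back s t : walk_step s t -> connect walk_step t s.
Proof.
case: s t => [[a b] c] [[b' c'] d] /and3P[/= /eqP-> /eqP-> K].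
apply: (connect_trans (y := (c, d, a))); first by rewrite connect1 // K4_walk_step // -K4_rot.
apply: (connect_trans (y := (d, a, b))); first by rewrite connect1 // K4_walk_step // -K4_rot -K4_rot.
by rewrite connect1 // K4_walk_step // K4_rot.
Qed.

Lemma walk_step_sym : connect_sym walk_step.
Proof.
suff imp s t : connect walk_step s t -> connect walk_step t s by move=> s t; apply/idP/idP; apply: imp.
case/connectP => p; elim: p s t => [|u p IH] s t /=; first by move=> _ ->.
by case/andP => su pu tE; apply: connect_trans (IH _ _ pu tE) (walk_step_back su).
Qed.

(** By [root_walk_step], inside a clique [abcd] the component [cls a b c] depends
    on the cyclic order [abcd] only, and [d] can be replaced freely. *)
Let cls a b c := fingraph.root walk_step (a, b, c).

Lemma root_walk_step a b c d : K4 E a b c d -> cls a b c = cls b c d.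
Proof. by move=> K; apply/(fingraph.rootP walk_step_sym)/connect1/K4_walk_step. Qed.

Lemma root_rot a b c d : K4 E a b c d ->
  [/\ cls a b c = cls b c d, cls b c d = cls c d a & cls c d a = cls d a b].
Proof.
by move=> K; split; apply: root_walk_step; rewrite // -K4_rot // -K4_rot.
Qed.

(** Put [e] in the place of one of [x], [y], move the other one, and take [e]
    out again; the three equations are the three ways in which [z], [w] can lie
    around the cyclic order. *)
Lemma root_swap x y z w : swappable x y z w ->
  [/\ cls z w x = cls z w y, cls w z x = cls w z y & cls z x w = cls z y w].
Proof.
case=> e [K1 K2].
have r1 : cls z w x = cls e z w by rewrite -(root_walk_step (a := e) (d := x)) // K4_rot.
have r1' : cls z w y = cls e z w by rewrite -(root_walk_step (a := e) (d := y)) // K4_rot.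
have r2 : cls w z x = cls e w z.
  by rewrite -(root_walk_step (a := e) (d := x)) // K4_rot K4_sym12.
have r2' : cls w z y = cls e w z.
  by rewrite -(root_walk_step (a := e) (d := y)) // K4_rot K4_sym12.
split; rewrite ?r1 ?r2 //.
(* In the order [z x w e], turn to [w e z x], replace [x] by [y], turn back. *)
have K1' : K4 E z x w e by rewrite K4_sym23.
have K2' : K4 E z y w e by rewrite K4_sym23.
have [-> -> _] := root_rot K1'; have [-> -> _] := root_rot K2'.
by [].
Qed.

(** A swappable pair at [a], together with a swappable pair joining it to the
    two other vertices, generates the symmetric group on three of the four
    vertices, which acts transitively on the six cyclic orders. *)
Lemma root_K4_perm a b c d : K4 E a b c d -> cls a b c = cls b a c /\ cls a b c = cls a c b.
Proof.
move=> K.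
have rots x y z w : K4 E x y z w -> [/\ cls x y z = cls y z w, cls y z w = cls z w x & cls z w x = cls w x y].
  exact: root_rot.
have K2 : K4 E a b d c by rewrite K4_sym34.
have K3 : K4 E a c b d by rewrite K4_sym23.
have K4' : K4 E a d b c by rewrite K4_sym23 K4_sym34 K4_sym23.
have K5 : K4 E a c d b by rewrite K4_sym34.
have K6 : K4 E a d c b by rewrite K4_sym34.
have [q1 q2 q3] := rots _ _ _ _ K; have [q4 q5 q6] := rots _ _ _ _ K2.
have [q7 q8 q9] := rots _ _ _ _ K3; have [q10 q11 q12] := rots _ _ _ _ K4'.
have [q13 q14 q15] := rots _ _ _ _ K5; have [q16 q17 q18] := rots _ _ _ _ K6.
have star := swappable_star K.
have cut1 := swappable_cut K; have cut2 := swappable_cut K3; have cut3 := swappable_cut K4'.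
move: q1 q2 q3 q4 q5 q6 q7 q8 q9 q10 q11 q12 q13 q14 q15 q16 q17 q18 cut1 cut2 cut3.
case: star => /root_swap[s1 s2 s3]; intros;
[case: cut1|case: cut2|case: cut3] => /root_swap[s4 s5 s6];
  clear -q1 q2 q3 q4 q5 q6 q7 q8 q9 q10 q11 q12 q13 q14 q15 q16 q17 q18 s1 s2 s3 s4 s5 s6;
  split; congruence.
Qed.

Lemma root_edge_perm a b c : E a b c -> cls a b c = cls b a c /\ cls a b c = cls a c b.
Proof. by move=> /edge_in_K4[d /root_K4_perm]. Qed.

Section Red.
Variable red : I -> I -> I -> bool.
Hypothesis red12 : forall x y z, red x y z = red y x z.
Hypothesis red23 : forall x y z, red x y z = red x z y.
Hypothesis redE : forall x y z, red x y z -> E x y z.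
Hypothesis redK4 : forall a b c d, K4 E a b c d -> red a b c -> red a b d.

(** If [E a u w] and [x] sees [u] and [w] in the link of [a] with colours that
    are not both that of [u w], the clique [a u w x] would be bichromatic, so
    [x] is a non-neighbour of [u] and [w]. *)
Lemma red_link a : link_coloring (red a) (fun u w => E a u w && ~~ red a u w).
Proof.
have jE u x : joined (red a) (fun u w => E a u w && ~~ red a u w) u x = E a u x.
  by rewrite /joined; case rx: (red a u x); rewrite /= ?andbT // redE.
have jE' u x : joined (fun u w => E a u w && ~~ red a u w) (red a) u x = E a u x.
  by have := jE u x; rewrite /joined orbC.
have K u w x : E a u w -> E a u x -> E a w x -> E u w x -> K4 E a u w x.
  by move=> *; apply/and4P.
split.
- by move=> x y; rewrite red23.
- by move=> x y; rewrite red23 s23.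
- by move=> x y -> /andP[].
- move=> u w; rewrite jE => auw; under eq_count_where => x do rewrite jE.
  by apply: (dense3_codeg D); have [] := dense3_neq3 D auw.
- move=> u w r; have auw := redE r; have [_ _ uw] := dense3_neq3 D auw.
  apply: leq_ltn_trans (dense3_codeg D uw); rewrite leq_mul2l /=.
  apply: sub_count_where => x; rewrite /off_color !jE => /and3P[aux awx].
  apply: contraNN => uwx; rewrite (redK4 (K _ _ _ auw aux awx uwx) r) /=.
  have K' : K4 E a w u x by rewrite K4_sym23; apply: K.
  by apply: redK4 K' _; rewrite red23.
- move=> u w /andP[auw nr]; have [_ _ uw] := dense3_neq3 D auw.
  apply: leq_ltn_trans (dense3_codeg D uw); rewrite leq_mul2l /=.
  apply: sub_count_where => x; rewrite /off_color !jE' => /and3P[aux awx].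
  apply: contraNN => uwx; rewrite aux awx /=; apply/andP; split; apply: contraNN nr => r.
    by apply: redK4 r; rewrite K4_sym34; apply: K.
  rewrite red23; apply: redK4 r; rewrite K4_sym34 K4_sym23; apply: K => //.
Qed.

Lemma same_color_pair a u x y : red a u x -> E a u y -> red a u y.
Proof.
move=> r e; apply: contraT => nr; case: (link_monochromatic (red_link a) r (y := y)).
by rewrite e nr.
Qed.

Lemma same_color_vertex a u x w y : red a u x -> E a w y -> red a w y.
Proof.
move=> r e; have [au _ _] := dense3_neq3 D (redE r); have [aw _ _] := dense3_neq3 D e.
have [] := @ninths_below_witness I [:: (2, fun x => ~~ E a u x); (2, fun x => ~~ E a w x)] 1;
  rewrite //=; first by do !split; apply: (dense3_codeg D).
move=> z h; have [auz awz] : E a u z /\ E a w z.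
  by move: h; clear; case: (E a u z); case: (E a w z).
have raz := same_color_pair r auz.
have : red a w z; last by move=> r'; apply: same_color_pair r' e.
rewrite red23; apply: (same_color_pair (x := u)); first by rewrite red23.
by rewrite s23.
Qed.

Lemma same_color_all a b c x y z : red a b c -> E x y z -> red x y z.
Proof.
move=> r e; have [ax|ax] := eqVneq a x.
  by move: e; rewrite -ax => e; apply: (same_color_vertex r e).
have [] := @ninths_below_witness I [:: (2, fun t => ~~ E a x t)] 1;
  rewrite //=; first by split=> //; apply: (dense3_codeg D).
move=> t h; have axt : E a x t by move: h; clear; case: (E a x t).
have := same_color_vertex r axt; rewrite red12 => r'.
exact: (same_color_vertex r' e).
Qed.
End Red.

(** The edges reachable from [(a, b, c)] in one order are reachable in all of
    them, hence form a symmetric set that is closed under cliques. *)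
Lemma dense3_connected a b c x y z :
  E a b c -> E x y z -> connect walk_step (a, b, c) (x, y, z).
Proof.
pose red u w t := E u w t && connect walk_step (a, b, c) (u, w, t).
have vE u w t : connect walk_step (a, b, c) (u, w, t) = (cls a b c == cls u w t).
  by apply/(fingraph.rootP walk_step_sym)/eqP.
move=> e1 e2; have : red a b c by rewrite /red e1 connect0.
suff red_prop : [/\ forall x y z, red x y z = red y x z, forall x y z, red x y z = red x z y,
   forall x y z, red x y z -> E x y z & forall a b c d, K4 E a b c d -> red a b c -> red a b d].
  by case: red_prop => p1 p2 p3 p4 r; have /andP[] := same_color_all p1 p2 p3 p4 r e2.
have p1 u w t : red u w t = red w u t.
  rewrite /red s12; case e: (E w u t) => //=; rewrite !vE.
  by have [-> _] := root_edge_perm e.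
have p2 u w t : red u w t = red u t w.
  rewrite /red s23; case e: (E u t w) => //=; rewrite !vE.
  by have [_ ->] := root_edge_perm e.
split=> //; first by move=> u w t /andP[].
move=> p q s t K; rewrite p2 p1 => /andP[_ cn].
have pqt : E p q t by case/and4P: K.
rewrite /red pqt /=; apply: connect_trans cn _; apply: connect1.
by apply: K4_walk_step; rewrite K4_sym12 K4_sym23.
Qed.

End Fixed.
End Core.

(** * Complete blow-ups in dense families of maps *)
Section Blowup.
Variable T : finType.

Definition ffun_cons k (x : T) (f : {ffun 'I_k -> T}) : {ffun 'I_k.+1 -> T} :=
  [ffun i => if unlift ord0 i is Some j then f j else x].

Lemma ffun_cons_eta k (f : {ffun 'I_k.+1 -> T}) :
  ffun_cons (f ord0) [ffun j => f (lift ord0 j)] = f.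
Proof.
by apply/ffunP => i; rewrite ffunE; case: unliftP => [j ->|->]; rewrite ?ffunE.
Qed.

Lemma sum_ffun_cons k (P : {ffun 'I_k.+1 -> T} -> nat) :
  \sum_f P f = \sum_x \sum_g P (ffun_cons x g).
Proof.
rewrite pair_big /= (reindex (fun p : T * {ffun 'I_k -> T} => ffun_cons p.1 p.2)) //=.
exists (fun f : {ffun 'I_k.+1 -> T} => (f ord0, [ffun j => f (lift ord0 j)])) => [[x f] _|f _] /=.
  congr (_, _); first by rewrite ffunE unlift_none.
  by apply/ffunP => j; rewrite !ffunE liftK.
exact: ffun_cons_eta.
Qed.

Lemma card_ffun_cons k (F : {set {ffun 'I_k.+1 -> T}}) :
  #|F| = \sum_f \sum_x (ffun_cons x f \in F).
Proof.
by rewrite -sum1_card big_mkcond /= sum_ffun_cons exchange_big.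
Qed.

Lemma ex_leq_sum (S : finType) (X : S -> nat) N :
  N <= \sum_s X s -> 0 < N -> exists s, N <= #|S| * X s.
Proof.
move=> le N0; have [s0 _] : exists s : S, true.
  case: (pickP (@predT S)) => [s _|S0]; first by exists s.
  by rewrite big_pred0 // leqNgt N0 in le.
exists [arg max_(s > s0) X s]; case: arg_maxnP => // s _ max.
apply: leq_trans le _; rewrite -sum_nat_const; apply: leq_sum => i _; exact: max.
Qed.

Lemma exp_le_ffact d t : (d - t) ^ t <= d ^_ t.
Proof.
elim: t d => [|t IH] d; first by rewrite ffactn0 expn0.
case: d => [|d]; first by rewrite sub0n exp0n.
rewrite ffactSS expnS subSS.
by apply: leq_mul (IH d); rewrite (leq_trans (leq_subr _ _)).
Qed.

Lemma leq_expl m n t : m <= n -> m ^ t <= n ^ t.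
Proof. by case: t => // t; rewrite leq_exp2r. Qed.
End Blowup.

(** Induction on the number of coordinates.  Many maps [f] on the last [k]
    coordinates have a large fibre, which contains many injective [t]-tuples of
    values for the first coordinate; by double counting one tuple [h] works for
    a positive proportion of the [f], and the induction hypothesis applies to
    these. *)
Lemma complete_blowup k t q : 0 < q -> exists n0, forall T : finType, n0 <= #|T| ->
  forall F : {set {ffun 'I_k -> T}}, #|T| ^ k <= q * #|F| ->
  exists g : 'I_k -> 'I_t -> T, (forall i, injective (g i)) /\
    forall c : 'I_k -> 'I_t, [ffun i => g i (c i)] \in F.
Proof.
elim: k q => [|k IH] q q0.
  exists 0 => T _ F; rewrite expn0 muln_gt0 q0 /= => /card_gt0P[f fF].
  have g : 'I_0 -> 'I_t -> T by case.
  exists g; split=> [[]//|c]; have -> // : [ffun i => g i (c i)] = f.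
  by apply/ffunP => -[].
pose q' := (4 * q) ^ t * (2 * q).
have q'0 : 0 < q' by rewrite muln_gt0 expn_gt0 !muln_gt0 q0.
have [n0 n0P] := IH q' q'0; exists (n0 + 4 * q * t + 1) => T big_T F large_F.
have Tn0 : n0 <= #|T| by lia.
have T0 : 0 < #|T| by lia.
pose fib f := [set x | ffun_cons x f \in F]; pose d f := #|fib f|.
have dE f : d f = \sum_x (ffun_cons x f \in F).
  by rewrite /d /fib -sum1dep_card big_mkcond.
pose Y := [set f : {ffun 'I_k -> T} | #|T| <= 2 * q * d f].
(* Maps with fibres smaller than [#|T| / (2 q)] account for at most half of [F]. *)
have large_Y : #|T| ^ k <= 2 * q * #|Y|.
  have : 2 * (q * #|F|) <= 2 * q * #|Y| * #|T| + #|T| ^ k * #|T|.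
    rewrite card_ffun_cons; under eq_bigr do rewrite -dE.
    rewrite (bigID (mem Y)) /= !mulnDr; apply: leq_add.
      rewrite mulnA -[X in _ <= X]mulnA leq_mul2l -sum_nat_const leq_sum ?orbT // => f _.
      exact: max_card.
    rewrite mulnA big_distrr /=.
    apply: (@leq_trans (\sum_(f : {ffun 'I_k -> T}) #|T|)); last first.
      by rewrite sum_nat_const card_ffun card_ord.
    rewrite big_mkcond /=; apply: leq_sum => f _.
    by rewrite inE -ltnNge; case: ifP => // /ltnW.
  move=> h; rewrite -(leq_pmul2r T0); move: h large_F; rewrite expnSr.
  by move: (#|T| ^ k) (#|F|) (#|Y|) => A B C0; clear; nia.
pose inj (h : {ffun 'I_t -> T}) := injectiveb h.
pose N (h : {ffun 'I_t -> T}) := \sum_(f in Y) [&& inj h & [forall j, h j \in fib f]].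
have sumN : #|T| ^ t * #|T| ^ k <= (4 * q) ^ t * (2 * q) * \sum_h N h.
  rewrite /N exchange_big /= -mulnA big_distrr /= big_distrr /=.
  apply: (@leq_trans (\sum_(f in Y) 2 * q * #|T| ^ t)).
    by rewrite sum_nat_const mulnC mulnA leq_mul2r (mulnC #|Y|) large_Y orbT.
  apply: leq_sum => f fY; rewrite mulnCA leq_mul2l; apply/orP; right.
  have -> : \sum_(h : {ffun 'I_t -> T}) [&& inj h & [forall j, h j \in fib f]] = d f ^_ t.
    rewrite /d -[in RHS](card_ord t) -(card_inj_ffuns_on 'I_t (mem (fib f))).
    rewrite -sum1dep_card [RHS]big_mkcond /=; apply: eq_bigr => h _.
    rewrite andbC /inj; case: (injectiveb h); rewrite ?andbF ?andbT //.
  apply: leq_trans (leq_mul (leqnn _) (exp_le_ffact _ _)).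
  rewrite -expnMn; apply: leq_expl; move: fY; rewrite inE.
  have : 4 * q * t <= #|T| by lia.
  rewrite mulnBr; clear; lia.
have [h h_large] : exists h, #|T| ^ k <= q' * N h.
  have [] := ex_leq_sum (X := fun h => (4 * q) ^ t * (2 * q) * N h) (N := #|T| ^ t * #|T| ^ k).
  - by rewrite -big_distrr.
  - by rewrite muln_gt0 !expn_gt0 T0.
  move=> h; rewrite card_ffun card_ord leq_pmul2l ?expn_gt0 ?T0 // => le.
  by exists h.
have inj_h : injective h.
  apply/injectiveP; case ih: (injectiveb h) => //.
  move: h_large; rewrite /N /inj ih big1 // muln0 leqn0 expn_eq0.
  by rewrite -leqn0 leqNgt T0.
pose F' := [set f | [forall j, ffun_cons (h j) f \in F]].
have [g [g_inj gP]] : exists g : 'I_k -> 'I_t -> T, (forall i, injective (g i)) /\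
    forall c : 'I_k -> 'I_t, [ffun i => g i (c i)] \in F'.
  apply: n0P => //; apply: leq_trans h_large _; rewrite leq_mul2l; apply/orP; right.
  rewrite /N big_mkcond -sum1_card [X in _ <= X]big_mkcond /=; apply: leq_sum => f _.
  case: ifP => // _; rewrite inE; case: (inj h) => //=.
  suff -> : [forall j, h j \in fib f] = [forall j, ffun_cons (h j) f \in F] by case: ifP.
  by apply: eq_forallb => j; rewrite inE.
exists (fun i => if unlift ord0 i is Some j then g j else h); split.
  by move=> i; case: unliftP => [j _|_].
move=> c; have := gP (fun j => c (lift ord0 j)); rewrite inE => /forallP/(_ (c ord0)).
congr (_ \in F); apply/ffunP => i; rewrite !ffunE.
by case: unliftP => [j ->|->]; rewrite ?ffunE ?unlift_none ?liftK.
Qed.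

(** * Random samples inherit the codegree condition *)
Section Sampling.
Local Open Scope ring_scope.
Variables (R : realFieldType) (T : finType) (E : T -> T -> T -> bool).
Variables (mu : R).
Hypothesis mu0 : 0 <= mu.
Hypothesis codeg : forall u v, u != v ->
  (count_where (fun x => ~~ E u v x))%:R <= mu * #|T|%:R :> R.
Variables (rho : R).
Hypothesis rho1 : 1 <= rho.
Local Notation n := (#|T|%:R : R).
Local Notation Omega := (rho ^+ 9).

Definition sample_nonnbrs C (f : {ffun 'I_C -> T}) i j :=
  count_where (fun k => ~~ E (f i) (f j) (f k)).

Definition bad_samples C (i j : 'I_C) : {set {ffun 'I_C -> T}} :=
  [set f : {ffun 'I_C -> T} | (f i != f j) && (2 * C <= 9 * sample_nonnbrs f i j)%N].

Lemma sum_weight u v : u != v ->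
  \sum_x Omega ^+ (~~ E u v x) <= n * (1 + (Omega - 1) * mu).
Proof.
move=> uv; have Om1 : 1 <= Omega by apply: exprn_ege1.
have -> : \sum_x Omega ^+ (~~ E u v x) = \sum_x (1 + (Omega - 1) * (~~ E u v x)%:R).
  apply: eq_bigr => x _; case: (E u v x); rewrite /= ?expr0 ?expr1 ?mulr0 ?addr0 //.
  by rewrite mulr1 addrC subrK.
rewrite big_split /= sumr_const -mulr_sumr -natr_sum mulrDr mulr1 lerD2l mulrCA.
by rewrite ler_wpM2l ?subr_ge0 // mulrC codeg.
Qed.

(** Exponential moments: [2 C <= 9 N] for the number [N] of sampled
    non-neighbours of a pair gives [rho ^ (2 C) <= Omega ^ N] with
    [Omega = rho ^ 9], and the sum of [Omega ^ N] over all samples factorises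
    over the coordinates. *)
Lemma card_bad_samples m (i j : 'I_m.+2) : i != j ->
  #|bad_samples i j|%:R * rho ^+ (2 * m.+2) <=
  n ^+ 2 * (Omega ^+ 2 * (n * (1 + (Omega - 1) * mu)) ^+ m).
Proof.
move=> ij; have Om1 : 1 <= Omega by apply: exprn_ege1.
have rho0 : 0 <= rho by apply: le_trans rho1; rewrite ler01.
have Om0 : 0 <= Omega by apply: exprn_ge0.
(* The weights vanish unless the coordinates [i] and [j] are [u] and [v]. *)
pose F u v (k : 'I_m.+2) (x : T) : R :=
  if k == i then (x == u)%:R * Omega else
  if k == j then (x == v)%:R * Omega else Omega ^+ (~~ E u v x).
have F0 u v k x : 0 <= F u v k x.
  rewrite /F; case: (k == i); last case: (k == j); rewrite ?exprn_ge0 //.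
    by rewrite mulr_ge0 ?ler0n.
  by rewrite mulr_ge0 ?ler0n.
have P0 (f : {ffun 'I_m.+2 -> T}) u v : 0 <= \prod_k F u v k (f k).
  by apply: prodr_ge0 => k _; exact: F0.
have step1 : #|bad_samples i j|%:R * rho ^+ (2 * m.+2) <=
    \sum_(f : {ffun 'I_m.+2 -> T}) \sum_u \sum_(v | v != u) \prod_k F u v k (f k).
  rewrite mulr_natl -sumr_const big_mkcond /=; apply: ler_sum => f _.
  have sum0 : 0 <= \sum_u \sum_(v | v != u) \prod_k F u v k (f k).
    by apply: sumr_ge0 => ? _; apply: sumr_ge0 => ? _; exact: P0.
  case: ifP => // fb; move: fb; rewrite inE => /andP[fij large].
  apply: (@le_trans _ _ (\prod_k F (f i) (f j) k (f k))); last first.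
    rewrite (bigD1 (f i)) //= (bigD1 (f j)) 1?eq_sym //= -addrA lerDl.
    apply: addr_ge0; first by apply: sumr_ge0 => ? _; exact: P0.
    by apply: sumr_ge0 => ? _; apply: sumr_ge0 => ? _; exact: P0.
  apply: (@le_trans _ _ (Omega ^+ sample_nonnbrs f i j)).
    by rewrite -exprM; apply: ler_weXn2l.
  rewrite /sample_nonnbrs /count_where -prodrXr; apply: ler_prod => k _.
  rewrite exprn_ge0 //= /F; have [->|_] := eqVneq k i.
    by rewrite eqxx mul1r; case: (E _ _ _); rewrite ?expr0 ?expr1.
  have [->|_] := eqVneq k j; last by [].
  by rewrite eqxx mul1r; case: (E _ _ _); rewrite ?expr0 ?expr1.
apply: le_trans step1 _; rewrite exchange_big /=.
have -> : n ^+ 2 * (Omega ^+ 2 * (n * (1 + (Omega - 1) * mu)) ^+ m) =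
    \sum_(u : T) \sum_(v : T) (Omega ^+ 2 * (n * (1 + (Omega - 1) * mu)) ^+ m).
  by rewrite !sumr_const -mulrnA -[RHS]mulr_natl natrM expr2.
apply: ler_sum => u _; rewrite exchange_big /= big_mkcond /=; apply: ler_sum => v _.
have S0 : 0 <= n * (1 + (Omega - 1) * mu).
  by rewrite mulr_ge0 ?addr_ge0 ?mulr_ge0 ?subr_ge0.
case: ifP => [vu|_]; last by rewrite mulr_ge0 ?exprn_ge0.
rewrite -bigA_distr_bigA /= (bigD1 i) //= (bigD1 j) 1?eq_sym //= mulrA.
have sum1 (w : T) : \sum_(x : T) (x == w)%:R * Omega = Omega.
  rewrite (bigD1 w) //= eqxx mul1r big1 ?addr0 // => x /negPf ->; exact: mul0r.
have -> : \sum_x F u v i x = Omega by rewrite /F eqxx.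
have -> : \sum_x F u v j x = Omega by rewrite /F eq_sym (negPf ij) eqxx.
rewrite -expr2; apply: ler_wpM2l; first exact: exprn_ge0.
have -> : (n * (1 + (Omega - 1) * mu)) ^+ m =
    \prod_(k in [set~ i] :\ j) (n * (1 + (Omega - 1) * mu)).
  rewrite prodr_const; congr (_ ^+ _).
  have := cardsD1 j [set~ i]; rewrite cardsC1 card_ord !inE eq_sym ij /=.
  by move=> /eqP; rewrite add1n eqSS => /eqP.
rewrite [X in _ <= X](eq_bigl (fun k => (k != i) && (k != j))); last first.
  by move=> k; rewrite !inE andbC.
apply: ler_prod => k /andP[ki kj]; rewrite sumr_ge0 //=.
rewrite /F (negPf ki) (negPf kj); apply: sum_weight; by rewrite eq_sym.
Qed.
End Sampling.

Section Decay.
Local Open Scope ring_scope.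
Variable R : archiRealFieldType.
Implicit Types (x k A d : R).

Lemma bernoulli_ge x n : 0 <= x -> x <= 1 -> 1 - n%:R * x <= (1 - x) ^+ n.
Proof.
move=> x0 x1; elim: n => [|n IH]; first by rewrite mul0r subr0 expr0.
rewrite exprS; apply: le_trans (ler_wpM2l _ IH); last by rewrite subr_ge0.
have : 0 <= n%:R * x * x by rewrite !mulr_ge0.
by rewrite -natr1; lra.
Qed.

Lemma bernoulli_le x n : 0 <= x -> 1 + n%:R * x <= (1 + x) ^+ n.
Proof.
move=> x0; elim: n => [|n IH]; first by rewrite mul0r addr0 expr0.
rewrite exprS; apply: le_trans (ler_wpM2l _ IH); last by rewrite addr_ge0.
have : 0 <= n%:R * x * x by rewrite !mulr_ge0.
by rewrite -natr1; lra.
Qed.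

(** With [t = 1 - k], [k (1 + t) <= 1] and [(1 + t) ^ (3 c) >= (c t) ^ 3], so the
    power beats the quadratic factor by [1 / c]. *)
Lemma quadratic_exp_decay k A d : 0 <= k -> k < 1 -> 0 <= A -> 0 < d ->
  exists m, (4 <= m)%N /\ m.+2%:R ^+ 2 * (A * k ^+ m) <= d.
Proof.
move=> k0 k1 A0 d0; have [t tE] : exists t, t = 1 - k by exists (1 - k).
have t0 : 0 < t by rewrite tE subr_gt0.
have [c [c2 cP]] : exists c, (2 <= c)%N /\ 25 * A <= c%:R * (t ^+ 3 * d).
  exists (Num.bound (25 * A / (t ^+ 3 * d))).+2; split=> //.
  rewrite -ler_pdivrMr ?mulr_gt0 ?exprn_gt0 //.
  apply: le_trans (ltW (archi_boundP _)) _.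
    by rewrite divr_ge0 ?mulr_ge0 ?exprn_ge0 ?(ltW t0) ?(ltW d0).
  by rewrite ler_nat (leq_trans (leqnSn _)).
exists (3 * c)%N; split; first by move: c2; clear; lia.
have c0 : 0 < c%:R :> R by rewrite ltr0n (leq_trans _ c2).
have kt : k ^+ (3 * c) * (c%:R * t) ^+ 3 <= 1.
  have h : (c%:R * t) ^+ 3 <= (1 + t) ^+ (3 * c).
    rewrite mulnC exprM; apply: lerXn2r; rewrite ?nnegrE ?mulr_ge0 ?exprn_ge0 ?addr_ge0 ?(ltW t0) //.
    by apply: le_trans (bernoulli_le c (ltW t0)); lra.
  apply: le_trans (ler_wpM2l (exprn_ge0 _ k0) h) _.
  rewrite -exprMn; apply: exprn_ile1; first by rewrite mulr_ge0 // addr_ge0 // ltW.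
  by rewrite tE; have := sqr_ge0 (1 - k); rewrite expr2; lra.
have sq : (3 * c).+2%:R ^+ 2 <= 25 * c%:R ^+ 2 :> R.
  by rewrite -natrX -(natrX R c) -natrM ler_nat; move: c2; clear; nia.
have kk0 : 0 <= A * k ^+ (3 * c) by rewrite mulr_ge0 ?exprn_ge0.
apply: le_trans (ler_wpM2r kk0 sq) _.
rewrite -(ler_pM2r (mulr_gt0 c0 (exprn_gt0 3 t0))).
have -> : 25 * c%:R ^+ 2 * (A * k ^+ (3 * c)) * (c%:R * t ^+ 3) =
  25 * A * (k ^+ (3 * c) * (c%:R * t) ^+ 3) by rewrite exprMn; ring.
apply: (@le_trans _ _ (25 * A)); last by move: cP; lra.
by rewrite -[leRHS]mulr1 ler_wpM2l // mulr_ge0.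
Qed.

(** To first order in [e = al / 2] the left side is [1 + 9 e (2 / 9 - 2 e)], below
    [1 + 2 e].  The error terms are controlled by [(1 - 8 e) rho ^ 8 <= 1], which
    is also equivalent to [rho ^ 9 - 1 <= 9 e rho ^ 8]. *)
Lemma sampling_rate (al : R) : 0 < al -> al <= 2 / 9 ->
  1 + ((1 + al / 2) ^+ 9 - 1) * (2 / 9 - al) < (1 + al / 2) ^+ 2.
Proof.
move=> a0 a1; pose e := al / 2; pose rho := 1 + e.
rewrite -/e -/rho.
have rho_gt0 : 0 < rho by rewrite /rho /e; lra.
have [e0 e1] : 0 < e /\ 9 * e <= 1 by rewrite /e; lra.
have h8 : (1 - 8 * e) * rho ^+ 8 <= 1.
  apply: (@le_trans _ _ ((1 - e) ^+ 8 * rho ^+ 8)).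
    by rewrite ler_wpM2r ?exprn_ge0 ?(ltW rho_gt0) // bernoulli_ge; lra.
  rewrite -exprMn /rho; apply: exprn_ile1; first by apply: mulr_ge0; lra.
  by have := sqr_ge0 e; rewrite expr2; lra.
have h9 : rho ^+ 9 - 1 <= 9 * e * rho ^+ 8.
  by have -> : rho ^+ 9 = (1 - 8 * e) * rho ^+ 8 + 9 * e * rho ^+ 8; [rewrite /rho; ring | lra].
have r8 : 0 <= rho ^+ 8 by rewrite exprn_ge0 ?(ltW rho_gt0).
have -> : 2 / 9 - al = 2 / 9 * (1 - 9 * e) by rewrite /e; lra.
have h10 : (rho ^+ 9 - 1) * (2 / 9 * (1 - 9 * e)) <= 9 * e * rho ^+ 8 * (2 / 9 * (1 - 9 * e)).
  by rewrite ler_wpM2r //; lra.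
have h11 : 9 * e * rho ^+ 8 * (2 / 9 * (1 - 9 * e)) <= 2 * e.
  have -> : 9 * e * rho ^+ 8 * (2 / 9 * (1 - 9 * e)) =
     2 * e * ((1 - 8 * e) * rho ^+ 8) - 2 * (e * (e * rho ^+ 8)) by field.
  have : 0 <= e * (e * rho ^+ 8) by apply: mulr_ge0; [exact: ltW | apply: mulr_ge0 => //; exact: ltW].
  have := ler_wpM2l (ltW e0) h8; rewrite mulr1; lra.
have : 0 < e ^+ 2 by rewrite exprn_gt0.
have -> : rho ^+ 2 = 1 + 2 * e + e ^+ 2 by rewrite /rho; ring.
move: (e ^+ 2) ((rho ^+ 9 - 1) * _) (9 * e * rho ^+ 8 * _) h10 h11; clear => x y z h1 h2 h3; lra.
Qed.
End Decay.

Section Counting.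
Variables (T : finType).
Implicit Types (A B : T -> T -> T -> bool).

Lemma ffun_cons0 k (x : T) (f : {ffun 'I_k -> T}) : ffun_cons x f ord0 = x.
Proof. by rewrite ffunE unlift_none. Qed.

Lemma ffun_consS k (x : T) (f : {ffun 'I_k -> T}) j : ffun_cons x f (lift ord0 j) = f j.
Proof. by rewrite ffunE liftK. Qed.

Definition triples A := \sum_x \sum_y \sum_z A x y z.

(** The first three points are to continue a path after one edge, and the next
    three, read backwards, to precede another edge. *)
Definition prefix_samples m A B : {set {ffun 'I_m.+4.+2 -> T}} :=
  [set f : {ffun 'I_m.+4.+2 -> T} |
    A (f ord0) (f (lift ord0 ord0)) (f (lift ord0 (lift ord0 ord0))) &&
    B (f (lift ord0 (lift ord0 (lift ord0 ord0))))
      (f (lift ord0 (lift ord0 (lift ord0 (lift ord0 ord0)))))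
      (f (lift ord0 (lift ord0 (lift ord0 (lift ord0 (lift ord0 ord0))))))].

Lemma card_prefix_samples m A B :
  #|prefix_samples m A B| = triples A * triples B * #|T| ^ m.
Proof.
rewrite -sum1dep_card big_mkcond /= /triples.
rewrite sum_ffun_cons !big_distrl /=; apply: eq_bigr => x0 _.
rewrite sum_ffun_cons !big_distrl /=; apply: eq_bigr => x1 _.
rewrite sum_ffun_cons !big_distrl /=; apply: eq_bigr => x2 _.
rewrite [X in _ = X * _]mulnC -[RHS]mulnA !big_distrl /= sum_ffun_cons; apply: eq_bigr => x3 _.
rewrite !big_distrl /= sum_ffun_cons; apply: eq_bigr => x4 _.
rewrite !big_distrl /= sum_ffun_cons; apply: eq_bigr => x5 _.
under eq_bigr do rewrite !ffun_consS !ffun_cons0.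
by rewrite sum_nat_const card_ffun card_ord; case: (A x0 x1 x2); case: (B x3 x4 x5);
  rewrite /= ?muln0 ?mul0n ?muln1 ?mul1n.
Qed.

(** Overwriting the coordinate [i] by an arbitrary value is injective on pairs
    of a member of [F] and a value. *)
Lemma card_determined C (i : 'I_C) (F : {set {ffun 'I_C -> T}}) :
  (forall f g, f \in F -> g \in F -> (forall k, k != i -> f k = g k) -> f = g) ->
  #|F| * #|T| <= #|T| ^ C.
Proof.
move=> det; pose upd (p : {ffun 'I_C -> T} * T) : {ffun 'I_C -> T} :=
  [ffun k => if k == i then p.2 else p.1 k].
rewrite -cardsT -cardsX -(card_in_imset (f := upd)).
  by apply: leq_trans (max_card _) _; rewrite card_ffun card_ord cardsT.
move=> [f x] [g y] /setXP[/= fF _] /setXP[/= gF _] eq_upd.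
have xy : x = y by have /ffunP/(_ i) := eq_upd; rewrite !ffunE eqxx.
congr (_, _) => //; apply: det => // k ki.
by have /ffunP/(_ k) := eq_upd; rewrite !ffunE (negPf ki).
Qed.

Variable E : T -> T -> T -> bool.
Hypothesis D : dense3 E.

Lemma K4_extensions a b c : E a b c -> #|T| <= 3 * count_where (K4 E a b c).
Proof.
move=> abc; have [ab ac bc] := dense3_neq3 D abc.
have h1 := dense3_codeg D ab; have h2 := dense3_codeg D ac; have h3 := dense3_codeg D bc.
have e := count_whereC (K4 E a b c).
suff : count_where (fun x => ~~ K4 E a b c x) <= count_where (fun x => ~~ E a b x)
    + count_where (fun x => ~~ E a c x) + count_where (fun x => ~~ E b c x).
  by move: h1 h2 h3 e; clear; simpl; lia.
rewrite -!big_split /=; apply: leq_sum => x _; rewrite /K4 abc.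
by case: (E a b x); case: (E a c x); case: (E b c x).
Qed.

Definition three_steps a b c x y z := [&& K4 E a b c x, K4 E b c x y & K4 E c x y z].

Lemma three_steps_many a b c : E a b c -> #|T| ^ 3 <= 3 ^ 3 * triples (three_steps a b c).
Proof.
move=> abc.
have ext u v w (X : T -> nat) M N : E u v w -> (forall x, K4 E u v w x -> M <= N * X x) ->
    #|T| * M <= 3 * N * \sum_x (K4 E u v w x) * X x.
  move=> uvw le; apply: leq_trans (leq_mul (K4_extensions uvw) (leqnn M)) _.
  rewrite -!mulnA leq_mul2l /= /count_where !big_distrl big_distrr /=.
  by apply: leq_sum => x _; case: (boolP (K4 E u v w x)) => // K; rewrite ?mul1n ?mul0n ?le.
rewrite (expnS _ 2) (expnS 3 2).
have -> : triples (three_steps a b c) = \sum_x (K4 E a b c x) *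
    \sum_y (K4 E b c x y) * \sum_z (K4 E c x y z) * 1.
  apply: eq_bigr => x _; rewrite big_distrr; apply: eq_bigr => y _.
  rewrite !big_distrr; apply: eq_bigr => z _; rewrite /three_steps /=.
  by case: (K4 E a b c x); case: (K4 E b c x y); case: (K4 E c x y z).
apply: (ext) => // x /and4P[_ _ _ bcx]; rewrite expnS (expnS 3 1).
apply: (ext) => // y /and4P[_ _ _ cxy]; rewrite -[#|T| ^ 1]muln1 expn1 expn1 -[X in X * \sum_z _]muln1.
exact: (ext).
Qed.
End Counting.

Definition good_sample (T : finType) (E : T -> T -> T -> bool) C (f : {ffun 'I_C -> T}) :=
  [forall i, forall j, (i != j) ==>
     (f i != f j) && (9 * sample_nonnbrs E f i j < 2 * C)].

Definition good_samples (T : finType) (E : T -> T -> T -> bool) (Z : {set T}) m A B :=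
  [set f in prefix_samples m A B | good_sample E f && [forall i, f i \notin Z]].

Section RealBound.
Local Open Scope ring_scope.
Variable R : archiRealFieldType.

Lemma rate_rescale (n Om s r : R) M : r != 0 ->
  n ^+ 2 * (Om ^+ 2 * (n * s) ^+ M) =
  n ^+ M.+2 * (Om ^+ 2 / r ^+ 4 * (s / r ^+ 2) ^+ M) * r ^+ (2 * M.+2).
Proof.
move=> r0; rewrite (_ : (2 * M.+2 = 2 * M + 4)%N); last by clear; lia.
rewrite exprD exprM (_ : M.+2 = M + 2)%N ?exprD; last by rewrite addn2.
move: (r ^+ 2) (r ^+ 4) (expf_neq0 2 r0) (expf_neq0 4 r0) => q b q0 b0.
rewrite !exprMn exprVn; move: (q ^+ M) (expf_neq0 M q0) => c c0.
by field; rewrite b0 c0.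
Qed.

(** For [al > 2 / 9] two distinct vertices would have a negative number of
    non-neighbours, so only [al <= 2 / 9] needs a choice of [m]. *)
Lemma rare_bad_samples (al : R) (K : nat) : 0 < al -> (0 < K)%N -> exists m, forall (T : finType) E,
  (forall u v : T, u != v ->
     (count_where (fun x => ~~ E u v x))%:R <= (2 / 9 - al) * #|T|%:R) ->
  (1 < #|T|)%N ->
  (K * \sum_(i < m.+4.+2) \sum_(j < m.+4.+2 | j != i) #|bad_samples E i j|
     <= #|T| ^ m.+4.+2)%N.
Proof.
move=> a0 K0; have [big|small] := ltP (2 / 9) al.
  exists 0%N => T E codeg /card_gt1P[u [v [_ _ uv]]].
  have T0 : (0 < #|T|%:R :> R) by rewrite ltr0n; apply/card_gt0P; exists u.
  have := le_trans (ler0n _ _) (codeg u v uv).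
  by rewrite pmulr_lge0 // subr_ge0 leNgt big.
pose rho := 1 + al / 2; pose Om := rho ^+ 9; pose s := 1 + (Om - 1) * (2 / 9 - al).
have rho1 : 1 <= rho by rewrite /rho; lra.
have rho0 : 0 < rho by rewrite /rho; lra.
have Om1 : 1 <= Om by apply: exprn_ege1.
have s0 : 0 <= s by rewrite addr_ge0 // mulr_ge0 ?subr_ge0.
have s1 : s < rho ^+ 2 by apply: sampling_rate.
pose A := Om ^+ 2 / rho ^+ 4; pose k := s / rho ^+ 2.
have A0 : 0 <= A by rewrite divr_ge0 ?exprn_ge0 // ltW.
have k0 : 0 <= k by rewrite divr_ge0 ?exprn_ge0 // ltW.
have k1 : k < 1 by rewrite ltr_pdivrMr ?exprn_gt0 // mul1r.
have d0 : 0 < K%:R^-1 :> R by rewrite invr_gt0 ltr0n.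
have [m0 [m4 decay]] := quadratic_exp_decay k0 k1 A0 d0.
case: m0 m4 decay => [|[|[|[|m]]]] // _ decay; exists m => T E codeg T2.
have mu0 : 0 <= 2 / 9 - al by rewrite subr_ge0.
have one (i j : 'I_m.+4.+2) : i != j -> #|bad_samples E i j|%:R <= #|T|%:R ^+ m.+4.+2 * (A * k ^+ m.+4) :> R.
  move=> ij; rewrite -(ler_pM2r (exprn_gt0 (2 * m.+4.+2) rho0)).
  rewrite -rate_rescale ?gt_eqF //.
  exact: (card_bad_samples mu0 codeg rho1 ij).
have dec0 : 0 <= A * k ^+ m.+4 by rewrite mulr_ge0 ?exprn_ge0.
rewrite -(ler_nat R) (natrM R K) natrX mulrC -ler_pdivlMr ?ltr0n //.
rewrite natr_sum; under eq_bigr do rewrite natr_sum.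
apply: (@le_trans _ _ (\sum_(i < m.+4.+2) \sum_(j < m.+4.+2)
     (#|T|%:R ^+ m.+4.+2 * (A * k ^+ m.+4)))).
  apply: ler_sum => i _; rewrite [leLHS]big_mkcond; apply: ler_sum => j _.
  case: ifP => [ji|_]; first by apply: one; rewrite eq_sym.
  by rewrite mulr_ge0 ?exprn_ge0.
rewrite !sumr_const card_ord -mulrnA -[leLHS]mulr_natl (natrM R) mulrCA.
by rewrite ler_wpM2l ?exprn_ge0 // -expr2.
Qed.
End RealBound.

(** Here [729 = 3 ^ 6] is the price of the six points of the prefix, [2916] is
    four times and [1458] twice as much: bad pairs and coincidences each cost at
    most a quarter of the samples with a correct prefix. *)
Lemma sample_budget N p g b c h Q : 2916 * b <= N -> N <= 729 * p ->
  p <= g + b + c + h -> c <= Q -> h <= 6 * Q -> 2916 * (7 * Q) <= N -> N <= 1458 * g.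
Proof. by lia. Qed.

Lemma many_good_samples (R : archiRealFieldType) (al : R) : (0 < al)%R ->
  exists m n1, forall (T : finType) (E : T -> T -> T -> bool), n1 <= #|T| ->
  (forall u v : T, u != v ->
     (count_where (fun x => ~~ E u v x))%:R <= (2 / 9 - al) * #|T|%:R)%R ->
  forall (Z : {set T}) A B, #|Z| <= 6 ->
  #|T| ^ 3 <= 3 ^ 3 * triples A -> #|T| ^ 3 <= 3 ^ 3 * triples B ->
  #|T| ^ m.+4.+2 <= 1458 * #|good_samples E Z m A B|.
Proof.
move=> al0; have [m mP] := rare_bad_samples (K := 2916) al0 isT; pose C := m.+4.+2.
exists m, (2916 * (7 * C ^ 2)) => T E big_T codeg Z A B Z6 largeA largeB.
have T1 : 1 < #|T|.
  by apply: leq_trans big_T; rewrite -[2]/(2 * 1) leq_mul // muln_gt0 /= expn_gt0.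
have T0 : 0 < #|T| by apply: ltnW.
have few_bad := mP T E codeg T1.
pose N := #|T| ^ C; pose M := #|T| ^ C.-1.
have NM : N = M * #|T| by rewrite /N /M -expnSr.
have coll (i j : 'I_C) : i != j -> #|[set f : {ffun 'I_C -> T} | f i == f j]| <= M.
  move=> ij; rewrite -(leq_pmul2r T0) -NM.
  apply: (@card_determined T C i) => f g; rewrite !inE => /eqP fij /eqP gij eq_fg.
  apply/ffunP => k; have [->|ki] := eqVneq k i; last exact: eq_fg.
  by rewrite fij gij eq_fg // eq_sym.
have hit (i : 'I_C) z : #|[set f : {ffun 'I_C -> T} | f i == z]| <= M.
  rewrite -(leq_pmul2r T0) -NM.
  apply: (@card_determined T C i) => f g; rewrite !inE => /eqP fi /eqP gi eq_fg.
  apply/ffunP => k; have [->|ki] := eqVneq k i; last exact: eq_fg.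
  by rewrite fi gi.
have split_pre : #|prefix_samples m A B| <= #|good_samples E Z m A B| +
   \sum_(i < C) \sum_(j < C | j != i) #|bad_samples E i j| +
   \sum_(i < C) \sum_(j < C | j != i) #|[set f : {ffun 'I_C -> T} | f i == f j]| +
   \sum_(i < C) \sum_(z in Z) #|[set f : {ffun 'I_C -> T} | f i == z]|.
  have cardE (F : {set {ffun 'I_C -> T}}) : #|F| = \sum_f (f \in F).
    by rewrite -sum1_card big_mkcond.
  under [X in _ + X + _ + _]eq_bigr do under eq_bigr do rewrite cardE.
  under [X in _ + _ + X + _]eq_bigr do under eq_bigr do rewrite cardE.
  under [X in _ + _ + _ + X]eq_bigr do under eq_bigr do rewrite cardE.
  under [X in _ + X + _ + _]eq_bigr do rewrite exchange_big.
  under [X in _ + _ + X + _]eq_bigr do rewrite exchange_big.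
  under [X in _ + _ + _ + X]eq_bigr do rewrite exchange_big.
  rewrite !cardE [X in _ + X + _ + _]exchange_big [X in _ + _ + X + _]exchange_big.
  rewrite [X in _ + _ + _ + X]exchange_big -!big_split /=; apply: leq_sum => f _.
  case: (boolP (f \in prefix_samples m A B)) => // pf.
  case: (boolP (f \in good_samples E Z m A B)) => [|ng]; first by rewrite -!addnA.
  rewrite add0n; set Sb := (X in X + _ + _); set Sc := (X in _ + X + _); set Sh := (X in _ + X).
  suff: [|| 0 < Sb, 0 < Sc | 0 < Sh] by clear; lia.
  move: ng; rewrite inE pf /= negb_and.
  case/orP => [/forallPn[i /forallPn[j]]|/forallPn[i]].
    rewrite negb_imply negb_and negbK => /andP[ij]; rewrite -leqNgt => fbad.
    have [fij|fij] := eqVneq (f i) (f j).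
      apply/or3P; apply: Or32; rewrite /Sc (bigD1 i) //= (bigD1 j) 1?eq_sym //=.
      by rewrite inE fij eqxx.
    apply/or3P; apply: Or31; rewrite /Sb (bigD1 i) //= (bigD1 j) 1?eq_sym //=.
    by move: fbad; rewrite inE (negPf fij) /= => ->.
  rewrite negbK => fiZ; apply/or3P; apply: Or33; rewrite /Sh (bigD1 i) //= (bigD1 (f i)) //=.
  by rewrite inE eqxx.
have few_coll : \sum_(i < C) \sum_(j < C | j != i) #|[set f : {ffun 'I_C -> T} | f i == f j]| <= C ^ 2 * M.
  apply: (@leq_trans (\sum_(i < C) \sum_(j < C) M)); last first.
    by rewrite !big_const_ord !iter_addn_0 -mulnA mulnC.
  apply: leq_sum => i _; rewrite big_mkcond; apply: leq_sum => j _.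
  by case: ifP => // ji; apply: coll; rewrite eq_sym.
have few_hit : \sum_(i < C) \sum_(z in Z) #|[set f : {ffun 'I_C -> T} | f i == z]| <= 6 * (C ^ 2 * M).
  apply: (@leq_trans (\sum_(i < C) 6 * M)); last first.
    rewrite mulnA big_const_ord iter_addn_0 mulnAC leq_mul2r; apply/orP; right.
    by apply: leq_mul => //; rewrite -[X in X <= _]expn1 leq_pexp2l.
  apply: leq_sum => i _; apply: (@leq_trans (#|Z| * M)); last by rewrite leq_mul2r Z6 orbT.
  by rewrite -sum_nat_const; apply: leq_sum => z _; apply: hit.
have large_pre : N <= 729 * #|prefix_samples m A B|.
  rewrite card_prefix_samples /N /C (_ : m.+4.+2 = 3 + 3 + m) // !expnD.
  rewrite mulnA leq_mul2r; apply/orP; right.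
  by apply: leq_trans (leq_mul largeA largeB) _; rewrite mulnACA.
have small_rest : 2916 * (7 * (C ^ 2 * M)) <= N.
  by rewrite NM (mulnA 7) (mulnA 2916) [X in _ <= X]mulnC leq_mul2r big_T orbT.
exact: (sample_budget few_bad large_pre split_pre few_coll few_hit small_rest).
Qed.

(** * Walks in a sample and their blow-up *)

(** Unlike in a squared tight path, vertices may be repeated. *)
Fixpoint squared_walk (T : finType) (E : T -> T -> T -> bool) (p : seq T) : bool :=
  if p is a :: q then
    (if q is [:: b, c, d & _] then K4 E a b c d else true) && squared_walk E q
  else true.

Section Walks.
Variables (T : finType) (E : T -> T -> T -> bool).

Lemma squared_walk_cat3 p q a b c : squared_walk E (p ++ [:: a; b; c]) -> squared_walk E [:: a, b, c & q] ->
  squared_walk E (p ++ [:: a, b, c & q]).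
Proof.
move=> + hq; elim: p => [|x p IH] //= /andP[hx /IH ->]; rewrite andbT.
by move: hx; case: p {IH} => [|y [|z [|w p]]] //=.
Qed.

Hypothesis D : dense3 E.

Lemma K4_rev a b c d : K4 E a b c d = K4 E d c b a.
Proof.
by rewrite (K4_rot D) (K4_sym12 D) (K4_sym34 D) (K4_sym23 D) (K4_sym12 D) (K4_sym34 D) (K4_sym12 D)
  (K4_sym23 D) (K4_sym12 D) (K4_sym34 D).
Qed.

Lemma bounded_walk a b c x y z : E a b c -> E x y z -> exists w,
  [/\ squared_walk E ([:: a; b; c] ++ w), exists w', [:: a; b; c] ++ w = w' ++ [:: x; y; z]
    & size w <= #|T| ^ 3].
Proof.
move=> abc xyz; have /connectP[p0 path0 last0] := dense3_connected D abc xyz.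
case/shortenP: path0 last0 => p path_p uniq_p _ last_p.
exists [seq s.2 | s <- p]; split.
- elim: p a b c {abc last_p uniq_p} path_p => [|[[b' c'] d] p IH] a b c //=.
  by case/andP => /and3P[/= /eqP-> /eqP-> K] /IH /= ->; rewrite K.
- elim: p a b c {abc uniq_p} path_p last_p => [|[[b' c'] d] p IH] a b c /=.
    by move=> _ [-> -> ->]; exists [::].
  case/andP => /and3P[/= /eqP-> /eqP-> _] /IH{}IH /IH[w' /= ->].
  by exists (a :: w').
- rewrite size_map; have <- : #|{: T * T * T}| = #|T| ^ 3.
    by rewrite !card_prod !expnS expn0 muln1 mulnA.
  by move/andP: uniq_p => [_ /card_uniqP <-]; apply: max_card.
Qed.
End Walks.

Section Lift.
Variables (C t : nat) (T : finType) (E : T -> T -> T -> bool).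
Variables (G : 'I_C -> 'I_C -> 'I_C -> bool) (g : 'I_C -> 'I_t.+1 -> T).
Hypothesis DG : dense3 G.
Hypothesis copyE : forall (c : 'I_C -> 'I_t.+1) i j k,
  G i j k = E (g i (c i)) (g j (c j)) (g k (c k)).

Fixpoint lift_walk (p : nat) (w : seq 'I_C) : seq T :=
  if w is i :: w' then g i (inord p) :: lift_walk p.+1 w' else [::].

Lemma size_lift_walk p w : size (lift_walk p w) = size w.
Proof. by elim: w p => //= i w IH p; rewrite IH. Qed.

Lemma lift_walk_cat p w1 w2 :
  lift_walk p (w1 ++ w2) = lift_walk p w1 ++ lift_walk (p + size w1) w2.
Proof.
elim: w1 p => [|i w1 IH] p /=; first by rewrite addn0.
by rewrite IH addSnnS.
Qed.

(** The three ends of an edge are distinct indices, so some choice of one copy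
    per index selects the prescribed copies of all three. *)
Lemma lift_edge i j k p q r : G i j k -> E (g i p) (g j q) (g k r).
Proof.
move=> Gijk; have [ij ik jk] := dense3_neq3 DG Gijk.
have := copyE (fun x => if x == i then p else if x == j then q else r) i j k.
by rewrite eqxx (eq_sym j i) (negPf ij) eqxx (eq_sym k i) (negPf ik) (eq_sym k j) (negPf jk) => <-.
Qed.

Lemma squared_walk_lift p w : squared_walk G w -> squared_walk E (lift_walk p w).
Proof.
elim: w p => //= i w IH p /andP[hw /IH ->]; rewrite andbT.
case: w hw {IH} => [|j [|k [|l w]]] //= /and4P[h1 h2 h3 h4].
by rewrite /K4 !lift_edge.
Qed.

Hypothesis g_inj : forall i, injective (g i).
Hypothesis g_disj : forall i j p q, i != j -> g i p != g j q.

Lemma mem_lift_walk x p w : x \in lift_walk p w ->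
  exists i q, [/\ p <= q, q < p + size w & x = g i (inord q)].
Proof.
elim: w p => //= i w IH p; rewrite inE => /orP[/eqP->|/IH[j [q [pq qs ->]]]].
  by exists i, p; rewrite leqnn addnS ltnS leq_addr.
by exists j, q; split=> //; [apply: ltnW | rewrite addnS -addSn].
Qed.

Lemma uniq_lift_walk p w : p + size w <= t.+1 -> uniq (lift_walk p w).
Proof.
elim: w p => //= i w IH p le_t; rewrite IH ?addSnnS // andbT.
apply/negP => /mem_lift_walk[j [q [pq qs]]] /eqP; have [<-|ij] := eqVneq i j; last first.
  by rewrite (negPf (g_disj _ _ ij)).
move=> /eqP/g_inj/(congr1 val) /=; rewrite !inordK; first by move=> e; rewrite e ltnn in pq.
  by move: qs le_t; clear; lia.
by move: le_t; clear; lia.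
Qed.
End Lift.

(** The number [t + 1] of copies exceeds the length of a walk on [C] indices, so
    the position of a visit along the walk can serve as the name of the copy. *)
Lemma connecting_path (R : archiRealFieldType) (al : R) : (0 < al)%R ->
  exists K n1, forall (T : finType) (E : T -> T -> T -> bool), n1 <= #|T| -> dense3 E ->
  (forall u v : T, u != v ->
     (count_where (fun x => ~~ E u v x))%:R <= (2 / 9 - al) * #|T|%:R)%R ->
  forall a1 a2 a3 c1 c2 c3, E a1 a2 a3 -> E c1 c2 c3 -> uniq [:: a1; a2; a3; c1; c2; c3] ->
  exists p, [/\ uniq p, squared_walk E p, take 3 p = [:: a1; a2; a3],
    exists p', p = p' ++ [:: c1; c2; c3] & size p <= K].
Proof.
move=> al0; have [m [n1 samples]] := many_good_samples al0; pose C := m.+4.+2.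
pose pat_type : finType := {ffun 'I_C * 'I_C * 'I_C -> bool}.
(* Among [#|pat_type|] possible 3-graphs on the indices, one is induced by at
   least the average number of good samples. *)
pose q := #|pat_type| * 1458; pose t := C ^ 3 + 3.
have q0 : 0 < q by rewrite muln_gt0 andbT card_ffun expn_gt0 card_bool.
have [n0 blowup] := complete_blowup C t.+1 q0.
exists (t + 6), (n1 + n0 + 1) => T E big_T D codeg a1 a2 a3 c1 c2 c3 Ea Ec uniq_ac.
pose Z := [set z in [:: a1; a2; a3; c1; c2; c3]].
have Z6 : #|Z| <= 6 by rewrite cardsE; apply: leq_trans (card_size _) _.
have Ec' : E c3 c2 c1 by rewrite (dense3_sym13 D).
have T0 : 0 < #|T| by move: big_T; clear; lia.
have large := samples T E (leq_trans (_ : _ <= n1 + n0 + 1) big_T) codeg Z _ _ Z6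
  (three_steps_many D Ea) (three_steps_many D Ec').
have {}large := large (leq_trans (leq_addr _ _) (leq_addr _ _)).
set F := good_samples _ _ _ _ _ in large.
pose pat (f : {ffun 'I_C -> T}) : pat_type := [ffun x => E (f x.1.1) (f x.1.2) (f x.2)].
have [G0 large_G0] : exists G0, #|T| ^ C <= q * #|[set f in F | pat f == G0]|.
  have [||G0 le] := ex_leq_sum (X := fun G0 : pat_type => 1458 * #|[set f in F | pat f == G0]|)
     (N := #|T| ^ C).
  - rewrite -big_distrr /=; apply: leq_trans large _; rewrite leq_mul2l /=.
    rewrite -sum1_card (partition_big pat predT) //=; apply: leq_sum => G0 _.
    by rewrite -sum1_card; apply: eq_leq; apply: eq_bigl => f; rewrite !inE.
  - by rewrite expn_gt0 T0.
  by exists G0; rewrite -mulnA.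
have [||g [g_inj gF]] := blowup T _ [set f in F | pat f == G0] => //.
  by move: big_T; clear; lia.
pose G i j k := G0 (i, j, k).
have in_F c : [ffun i => g i (c i)] \in F by have := gF c; rewrite inE => /andP[].
have copyE c i j k : G i j k = E (g i (c i)) (g j (c j)) (g k (c k)).
  by rewrite /G; have := gF c; rewrite inE => /andP[_ /eqP <-]; rewrite !ffunE.
have good c : good_sample E [ffun i => g i (c i)].
  by have := in_F c; rewrite inE => /and3P[].
have avoid c i : g i (c i) \notin Z.
  by have := in_F c; rewrite inE => /and3P[_ _ /forallP/(_ i)]; rewrite ffunE.
have DG : dense3 G.
  pose c0 : 'I_C -> 'I_t.+1 := fun _ => ord0.
  split=> [x y z|x y z|x y|u v uv]; rewrite ?(copyE c0).
  - exact: dense3_sym12.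
  - exact: dense3_sym23.
  - exact: dense3_irr.
  have := good c0; move=> /forallP/(_ u)/forallP/(_ v); rewrite uv /= => /andP[_].
  rewrite card_ord; congr (9 * _ < _); apply: eq_count_where => x.
  by rewrite (copyE c0) !ffunE.
have g_disj i j p r : i != j -> g i p != g j r.
  move=> ij; have := good (fun x => if x == i then p else r).
  move=> /forallP/(_ i)/forallP/(_ j); rewrite ij /= !ffunE eqxx (eq_sym j i) (negPf ij).
  by case/andP.
pose i0 : 'I_C := ord0; pose i1 : 'I_C := lift ord0 ord0.
pose i2 : 'I_C := lift ord0 (lift ord0 ord0).
pose i3 : 'I_C := lift ord0 (lift ord0 (lift ord0 ord0)).
pose i4 : 'I_C := lift ord0 (lift ord0 (lift ord0 (lift ord0 ord0))).
pose i5 : 'I_C := lift ord0 (lift ord0 (lift ord0 (lift ord0 (lift ord0 ord0)))).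
have prefix c : three_steps E a1 a2 a3 (g i0 (c i0)) (g i1 (c i1)) (g i2 (c i2)) /\
    three_steps E c3 c2 c1 (g i3 (c i3)) (g i4 (c i4)) (g i5 (c i5)).
  by have := in_F c; rewrite inE => /and3P[]; rewrite inE !ffunE => /andP[].
have [G012 G543] : G i0 i1 i2 /\ G i5 i4 i3.
  rewrite !(copyE (fun=> ord0)); have [/and3P[_ _ K1] /and3P[_ _ K2]] := prefix (fun=> ord0).
  split; first by case/and4P: K1.
  by rewrite (dense3_sym13 D); case/and4P: K2.
have [w [sqw_w [w' wE] size_w]] := bounded_walk DG G012 G543.
rewrite card_ord in size_w.
set W := [:: i0; i1; i2] ++ w in sqw_w wE.
have size_W : size W = 3 + size w by [].
pose L := lift_walk g 0 W.
have sqwL : squared_walk E L by apply: squared_walk_lift DG copyE _ _ sqw_w.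
have uniqL : uniq L.
  apply: (uniq_lift_walk g_inj g_disj); rewrite size_W /t; move: size_w; clear; lia.
have LZ x : x \in L -> x \notin Z.
  by move=> /mem_lift_walk[i [r [_ _ ->]]]; apply: (avoid (fun=> inord r)).
have [s [u4' [u5' [u6' LE]]]] : exists s p1 p2 p3,
    L = s ++ [:: g i5 p1; g i4 p2; g i3 p3].
  rewrite /L wE lift_walk_cat /=; by do 4!eexists.
have ends : squared_walk E [:: g i5 u4', g i4 u5', g i3 u6' & [:: c1; c2; c3]].
  have := (prefix (fun x => if x == i5 then u4' else if x == i4 then u5' else u6')).2.
  rewrite !eqxx /= => /and3P[k1 k2 k3].
  by rewrite /= (K4_rev D (g i5 _)) (K4_rev D (g i4 _)) (K4_rev D (g i3 _)) k1 k2 k3.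
exists ([:: a1; a2; a3] ++ L ++ [:: c1; c2; c3]); split=> //.
- rewrite uniq_catCA cat_uniq uniqL uniq_ac andbT.
  by apply/hasPn => x xac; apply/negP => /LZ; rewrite inE xac.
- rewrite LE -catA catA; apply: squared_walk_cat3 => //; rewrite -catA -LE.
  have := (prefix (fun x => if x == i0 then inord 0 else if x == i1 then inord 1 else inord 2)).1.
  rewrite !eqxx /= => /and3P[k1 k2 k3].
  by move: sqwL; rewrite /L /= k1 k2 k3 => ->.
- by exists ([:: a1; a2; a3] ++ L); rewrite -catA.
- have sL : size L = 3 + size w by rewrite size_lift_walk.
  by rewrite !size_cat sL /t; move: size_w; clear; simpl; lia.
Qed.

(** * Greedy choice of the paths *)

(** The set [D i] reserves vertices for the [i]-th path: earlier paths avoid it,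
    which keeps their union [U] a legitimate obstacle when [i] comes. *)
Lemma greedy_disjoint (T : finType) (s K : nat) (good : 'I_s -> seq T -> Prop)
    (D : 'I_s -> {set T}) :
  (forall i (U : {set T}), #|U| <= s * K -> [disjoint U & D i] ->
     exists p, [/\ good i p, size p <= K & [disjoint p & U]]) ->
  (forall i j p, good i p -> i != j -> [disjoint p & D j]) ->
  exists P : 'I_s -> seq T, (forall i, good i (P i) /\ size (P i) <= K) /\
    forall i j, i != j -> [disjoint P i & P j].
Proof.
move=> ext goodD.
suff build k : k <= s -> exists P : 'I_s -> seq T,
    (forall i : 'I_s, i < k -> good i (P i) /\ size (P i) <= K) /\
    forall i j : 'I_s, i < k -> j < k -> i != j -> [disjoint P i & P j].
  by have [P [h1 h2]] := build s (leqnn s); exists P; split=> *; [apply: h1 | apply: h2].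
elim: k => [|k IH] ks; first by exists (fun=> [::]).
have [P [goodP disjP]] := IH (ltnW ks); pose k' := Ordinal ks.
pose U := \bigcup_(i < s | i < k) [set z in P i].
have cardU : #|U| <= s * K.
  apply: leq_trans (_ : \sum_(i < s) K <= _); last by rewrite sum_nat_const card_ord.
  rewrite (bigID (fun i : 'I_s => i < k)) /= (leq_trans _ (leq_addr _ _)) //.
  rewrite /U; elim/big_rec2: _ => [|i m A ik le]; first by rewrite cards0.
  rewrite (leq_trans (leq_card_setU _ _)) // leq_add // cardsE.
  by apply: leq_trans (card_size _) (goodP i ik).2.
have UD : [disjoint U & D k'].
  rewrite disjoint_sym; apply/bigcup_disjointP => i ik; rewrite disjoint_sym.
  have ik' : i != k' by apply: contraTneq ik => ->; rewrite ltnn.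
  have := goodD i k' _ (goodP i ik).1 ik'.
  by congr (is_true _); apply: eq_disjoint => z; rewrite inE.
have [p [good_p size_p pU]] := ext k' U cardU UD.
have dis_p (i : 'I_s) : i < k -> [disjoint p & P i].
  move=> ik; apply: disjointWr pU; apply/subsetP => z zP.
  by apply/bigcupP; exists i; rewrite ?inE.
exists (fun i => if i == k' then p else P i); split=> [i|i j].
  rewrite ltnS leq_eqVlt => /orP[/eqP ik|ik].
    have -> : i = k' by apply: val_inj.
    by rewrite eqxx.
  have /negPf -> : i != k' by apply: contraTneq ik => ->; rewrite ltnn.
  exact: goodP.
have neq (l : 'I_s) : l < k.+1 -> l != k' -> l < k.
  by rewrite ltnS leq_eqVlt => /orP[/eqP lk /eqP[]|//]; apply: val_inj.
move=> ik jk ij; have [ei|/(neq i ik) ik'] := eqVneq i k'; have [ej|/(neq j jk) jk'] := eqVneq j k'.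
- by rewrite ei ej eqxx in ij.
- exact: dis_p.
- by rewrite disjoint_sym; apply: dis_p.
- exact: disjP.
Qed.

(** * From set systems to symmetric relations and back *)
Section Transfer.
Variables (T : finType).
Implicit Types (H : graph3 T) (X : {set T}).

Definition edge_rel3 H u v w := [set u; v; w] \in edges H.

Lemma edge_rel3_card H u v w : edge_rel3 H u v w -> #|[set u; v; w]| = 3.
Proof. by move=> /edgesP/andP[_ /eqP]. Qed.

Lemma edge_rel3_neq H u v w : edge_rel3 H u v w -> u != v.
Proof.
move=> /edge_rel3_card; apply: contra_eq_neq => ->; rewrite setUid.
by rewrite neq_ltn cards2; case: (_ == _).
Qed.

(** Every edge through [u] and [v] is [[set u; v; w]] for some [w]. *)
Lemma codegree_le H u v : u != v -> codegree H u v <= #|[set w | edge_rel3 H u v w]|.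
Proof.
move=> uv; apply: leq_trans (leq_imset_card (fun w => [set u; v; w]) _).
apply: subset_leq_card; apply/subsetP => e; rewrite inE => /andP[eH /andP[ue ve]].
have /andP[_ /eqP e3] := edgesP eH.
have /card_gt0P[w] : 0 < #|e :\ u :\ v|.
  have := cardsD1 u e; rewrite ue e3 => c1.
  have := cardsD1 v (e :\ u); rewrite !inE eq_sym uv ve /= => c2.
  by move: c1 c2; clear; lia.
rewrite !inE => /and3P[wv wu we].
have eE : e = [set u; v; w].
  apply/esym/eqP; rewrite eqEcard e3 !subUset !sub1set ue ve we /=.
  by rewrite -setUA cardsU1 !inE negb_or uv (eq_sym u) wu cards2 (eq_sym v) wv.
by apply/imsetP; exists w => //; rewrite inE /edge_rel3 -eE.
Qed.

Lemma squared_walk_map (S : finType) (h : S -> T) (E : T -> T -> T -> bool) p :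
  squared_walk E (map h p) = squared_walk (fun u v w => E (h u) (h v) (h w)) p.
Proof. by elim: p => //= a p ->; case: p => [|b [|c [|d p]]]. Qed.

Lemma squared_walk_window (E : T -> T -> T -> bool) p i : squared_walk E p -> i + 4 <= size p ->
  exists a b c d, take 4 (drop i p) = [:: a; b; c; d] /\ K4 E a b c d.
Proof.
elim: p i => [|a p IH] i; first by rewrite leqn0 addn_eq0 andbF.
case: i => [|i] /=.
  move=> /andP[h _]; case: p h {IH} => [|b [|c [|d p]]] //= h _.
  by exists a, b, c, d; rewrite take0.
by rewrite addSn ltnS => /andP[_ h]; apply: IH.
Qed.

Lemma edge_rel3_perm H a b c : edge_rel3 H a b c = edge_rel3 H b a c /\
  edge_rel3 H a b c = edge_rel3 H a c b.
Proof. by split; rewrite /edge_rel3; [rewrite (setUC [set a]) | rewrite setUAC]. Qed.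

(** A 3-subset of [{a, b, c, d}] omits exactly one of the four vertices. *)
Lemma is_K43_of_K4 H X a b c d : uniq [:: a; b; c; d] ->
  {subset [:: a; b; c; d] <= verts H :\: X} -> K4 (edge_rel3 H) a b c d ->
  is_K43 (del_verts H X) [set z in [:: a; b; c; d]].
Proof.
move=> uniq_p sub_p /and4P[abc abd acd bcd].
have sub_A : [set z in [:: a; b; c; d]] \subset verts H :\: X.
  by apply/subsetP => z; rewrite inE; apply: sub_p.
have card_A : #|[set z in [:: a; b; c; d]]| = 4 by rewrite cardsE (card_uniqP uniq_p).
apply/and3P; split; rewrite ?card_A //.
apply/forallP => e; apply/implyP => /andP[eA /eqP e3].
rewrite inE (subset_trans eA sub_A) andbT.
have /cards1P[z zE] : #|[set z in [:: a; b; c; d]] :\: e| == 1.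
  by rewrite cardsD (setIidPr eA) card_A e3.
have zA : z \in [:: a; b; c; d].
  have : z \in [set z in [:: a; b; c; d]] :\: e by rewrite zE set11.
  by rewrite !inE => /andP[_].
have -> : e = [set z in [:: a; b; c; d]] :\ z.
  by rewrite -zE setDDr setDv set0U (setIidPr eA).
move: uniq_p; rewrite /= !inE !negb_or -!andbA => /and4P[ab ac ad /and3P[bc bd /andP[cd _]]].
rewrite !inE in zA; case/or4P: zA => /eqP->.
- suff -> : [set z in [:: a; b; c; d]] :\ a = [set b; c; d] by [].
  apply/setP => t; rewrite !inE -orbA; case: eqVneq => [->|_] //=.
  by rewrite (negPf ab) (negPf ac) (negPf ad).
- suff -> : [set z in [:: a; b; c; d]] :\ b = [set a; c; d] by [].
  apply/setP => t; rewrite !inE -orbA; case: (eqVneq t b) => [->|_] //=.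
  by rewrite eq_sym (negPf ab) (negPf bc) (negPf bd).
- suff -> : [set z in [:: a; b; c; d]] :\ c = [set a; b; d] by [].
  apply/setP => t; rewrite !inE -orbA; case: (eqVneq t c) => [->|_] //=.
  by rewrite eq_sym (negPf ac) eq_sym (negPf bc) (negPf cd).
- suff -> : [set z in [:: a; b; c; d]] :\ d = [set a; b; c] by [].
  apply/setP => t; rewrite !inE -orbA; case: (eqVneq t d) => [->|_] //=; rewrite ?orbF //.
  by rewrite eq_sym (negPf ad) eq_sym (negPf bd) eq_sym (negPf cd).
Qed.
End Transfer.

Lemma tuple3E (T : eqType) (t : 3.-tuple T) : exists a b c, t = [:: a; b; c] :> seq T.
Proof. by case: t => [[|a [|b [|c [|d s]]]]] //= _; exists a, b, c. Qed.

Lemma triple_edgeE (T : finType) (H : graph3 T) (X : {set T}) (t : 3.-tuple T) a b c :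
  t = [:: a; b; c] :> seq T -> triple_edge (del_verts H X) t ->
  [/\ edge_rel3 H a b c, uniq t & {subset t <= verts H :\: X}].
Proof.
move=> tE; rewrite /triple_edge /= inE => /andP[tH tX].
have memE z : (z \in t) = (z \in [:: a; b; c]) by rewrite -tE.
have setE : [set z in t] = [set a; b; c] by apply/setP => z; rewrite inE memE !inE orbA.
have e : edge_rel3 H a b c by rewrite /edge_rel3 -setE.
split=> //; last by move=> z zt; apply: (subsetP tX); rewrite inE.
by apply/card_uniqP; rewrite size_tuple -cardsE setE (edge_rel3_card e).
Qed.

Section Avoiding.
Local Open Scope ring_scope.
Variable R : realType.

(** Deleting [X] does not increase the number of non-neighbours of a pair, at
    most [(2 / 9 - alpha) n], and this is at most [2 / 9 - alpha / 2] times the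
    number of remaining vertices. *)
Lemma connect_avoiding (alpha : R) : 0 < alpha -> exists K n1,
  forall (T : finType) (H : graph3 T) (X : {set T}),
  (2 * n1 + 2 <= #|verts H|)%N ->
  (7 / 9 + alpha) * #|verts H|%:R <= (min_codegree H)%:R ->
  #|X|%:R <= alpha * #|verts H|%:R -> (2 * #|X| <= #|verts H|)%N ->
  forall x y : 3.-tuple T,
  triple_edge (del_verts H X) x -> triple_edge (del_verts H X) y ->
  vertex_disjoint x y -> exists p, [/\ squared_tight_path (del_verts H X) p,
    path_from_to p x y & (size p <= K)%N].
Proof.
move=> alpha0; have [K [n1 conn]] := @connecting_path R (alpha / 2) (divr_gt0 alpha0 (ltr0n _ 2)).
exists K, n1 => T H X n_large codeg X_small X_half x y xe ye xy.
set n := #|verts H| in n_large codeg X_small X_half.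
have [a1 [a2 [a3 xE]]] := tuple3E x; have [c1 [c2 [c3 yE]]] := tuple3E y.
have [ea ux sx] := triple_edgeE xE xe; have [ec uy sy] := triple_edgeE yE ye.
pose V := verts H :\: X; pose S := {v | v \in V}.
have cardS : #|{: S}| = #|V| by rewrite card_sig; apply: eq_card => v; rewrite inE.
have cardV : (n <= #|V| + #|X|)%N.
  have := subset_leq_card (subsetIr (verts H) X); rewrite /V cardsD -/n; clear; lia.
have cardVn : (#|V| <= n)%N by apply: subset_leq_card; apply: subsetDl.
pose E (u v w : S) := edge_rel3 H (val u) (val v) (val w).
have miss (u v : S) : u != v ->
    (count_where (fun w => ~~ E u v w) + codegree H (val u) (val v) <= n)%N.
  move=> uv; have uv' : val u != val v by rewrite val_eqE.
  have cw := @codegree_le T H _ _ uv'.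
  apply: (leq_trans (leq_add (leqnn _) cw)).
  rewrite count_whereE -(card_imset _ val_inj) -cardsUI.
  rewrite (_ : _ :&: _ = set0) ?cards0 ?addn0; last first.
    apply/setP => w; rewrite !inE; apply/andP => -[/imsetP[z]].
    by rewrite inE => nz -> e; case/negP: nz.
  apply: subset_leq_card; rewrite subUset; apply/andP; split.
    by apply/subsetP => w /imsetP[z _ ->]; have := valP z; rewrite inE => /andP[].
  apply/subsetP => w; rewrite inE => /edgesP/andP[/subsetP sub _].
  by apply: sub; rewrite !inE eqxx orbT.
have n0 : (0 < n%:R :> R) by rewrite ltr0n; move: n_large; clear; lia.
have cod (u v : S) : u != v -> (7 / 9 + alpha) * n%:R <= (codegree H (val u) (val v))%:R.
  move=> uv; apply: le_trans codeg _; rewrite ler_nat.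
  have n1' : (1 < #|verts H|)%N by rewrite -/n; move: n_large; clear; lia.
  have := min_codegree_geP (min_codegree H) n1'; rewrite leqnn => /elimT -> //.
  - by have := valP u; rewrite inE => /andP[].
  - by have := valP v; rewrite inE => /andP[].
have missR (u v : S) : u != v ->
    (count_where (fun w => ~~ E u v w))%:R <= (2 / 9 - alpha / 2) * #|{: S}|%:R :> R.
  move=> uv; have h1 := cod u v uv.
  have h2 : (count_where (fun w => ~~ E u v w))%:R + (codegree H (val u) (val v))%:R <= n%:R :> R.
    by rewrite -natrD ler_nat miss.
  have h3 : n%:R <= #|V|%:R + #|X|%:R :> R by rewrite -natrD ler_nat.
  have h4 : #|V|%:R <= n%:R :> R by rewrite ler_nat.
  have h5 : 0 <= alpha * (n%:R - #|V|%:R) by apply: mulr_ge0; [exact: ltW | rewrite subr_ge0].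
  rewrite cardS; move: h1 h2 h3 h4 h5 X_small.
  move: (count_where _)%:R (codegree _ _ _)%:R #|V|%:R #|X|%:R n%:R => q w v' x' n'.
  by move=> h1 h2 h3 h4 h5 h6; lra.
have D : dense3 E.
  split=> [u v w|u v w|u v|u v uv].
  - by case: (edge_rel3_perm H (val u) (val v) (val w)).
  - by case: (edge_rel3_perm H (val u) (val v) (val w)).
  - by apply/negP => /edge_rel3_neq; rewrite eqxx.
  rewrite -(ltr_nat R) !natrM; have := missR u v uv.
  have : 0 < alpha / 2 * #|{: S}|%:R.
    by rewrite mulr_gt0 ?divr_gt0 // ltr0n cardS; move: cardV X_half n_large; clear; lia.
  by lra.
have memE (t : 3.-tuple T) a b c : t = [:: a; b; c] :> seq T -> t =i [:: a; b; c] by move=> tE z; rewrite -tE.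
have va1 : a1 \in V by apply: sx; rewrite (memE _ _ _ _ xE) !inE eqxx ?orbT.
have va2 : a2 \in V by apply: sx; rewrite (memE _ _ _ _ xE) !inE eqxx ?orbT.
have va3 : a3 \in V by apply: sx; rewrite (memE _ _ _ _ xE) !inE eqxx ?orbT.
have vc1 : c1 \in V by apply: sy; rewrite (memE _ _ _ _ yE) !inE eqxx ?orbT.
have vc2 : c2 \in V by apply: sy; rewrite (memE _ _ _ _ yE) !inE eqxx ?orbT.
have vc3 : c3 \in V by apply: sy; rewrite (memE _ _ _ _ yE) !inE eqxx ?orbT.
have uniq_xy : uniq ([:: a1; a2; a3] ++ [:: c1; c2; c3]).
  by rewrite -xE -yE cat_uniq ux uy andbT /= -disjoint_has disjoint_sym.
have S_large : (n1 <= #|{: S}|)%N by rewrite cardS; move: cardV X_half n_large; clear; lia.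
pose sa1 : S := exist _ a1 va1; pose sa2 : S := exist _ a2 va2; pose sa3 : S := exist _ a3 va3.
pose sc1 : S := exist _ c1 vc1; pose sc2 : S := exist _ c2 vc2; pose sc3 : S := exist _ c3 vc3.
have uniq_S : uniq [:: sa1; sa2; sa3; sc1; sc2; sc3] by rewrite -(map_inj_uniq val_inj).
have [p [uniq_p sqw_p start_p [p' end_p] size_p]] :=
  conn S E S_large D missR sa1 sa2 sa3 sc1 sc2 sc3 ea ec uniq_S.
pose q := [seq val z | z <- p].
have uniq_q : uniq q by rewrite map_inj_uniq //; apply: val_inj.
have sub_q : {subset q <= V} by move=> z /mapP[w _ ->]; apply: valP.
have sqw_q : squared_walk (edge_rel3 H) q by rewrite squared_walk_map.
exists q; split; last by rewrite size_map.
- split=> // i /(squared_walk_window sqw_q)[a [b [c [d [wE wK]]]]]; rewrite wE; apply: is_K43_of_K4 => //.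
    by rewrite -wE take_uniq // drop_uniq.
  by move=> z; rewrite -wE => /mem_take/mem_drop/sub_q.
- split; first by rewrite xE /q -map_take start_p.
  rewrite yE /q end_p map_cat size_cat /= addnK drop_size_cat //.
Qed.

Lemma squared_tight_pathS (T : finType) (H : graph3 T) (X Y : {set T}) p : X \subset Y ->
  squared_tight_path (del_verts H Y) p -> squared_tight_path (del_verts H X) p.
Proof.
move=> XY [uniq_p sub_p win]; have sub : verts H :\: Y \subset verts H :\: X by apply: setDS.
split=> // [z /sub_p|i le]; first exact: (subsetP sub).
have /and3P[A1 A2 /forallP A3] := win i le; apply/and3P; split=> //.
  exact: subset_trans A1 sub.
apply/forallP => e; apply/implyP => he; have := A3 e; rewrite he /= !inE => /andP[-> eY].
exact: subset_trans eY sub.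
Qed.

Lemma triple_edge_delS (T : finType) (H : graph3 T) (X Y : {set T}) (t : 3.-tuple T) :
  triple_edge (del_verts H X) t -> {subset t <= verts H :\: Y} ->
  triple_edge (del_verts H Y) t.
Proof.
rewrite /triple_edge /= !inE => /andP[-> _] tY /=.
by apply/subsetP => z; rewrite inE => /tY.
Qed.
End Avoiding.

Local Open Scope ring_scope.

Theorem lemma1p5 (R : realType) :
  forall alpha : R, 0 < alpha ->
  exists psi0 : R, 0 < psi0 /\
  forall psi : R, 0 < psi -> psi <= psi0 ->
  exists n0 : nat, forall n : nat, (n0 <= n)%N ->
  forall (T : finType) (H : graph3 T), #|verts H| = n ->
  (7 / 9 + alpha) * n%:R <= (min_codegree H)%:R ->
  forall X : {set T}, X \subset verts H -> #|X|%:R <= psi * n%:R ->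
  forall s : nat, s%:R <= psi * n%:R ->
  forall x y : 'I_s -> 3.-tuple T,
  (forall i, triple_edge (del_verts H X) (x i)) ->
  (forall i, triple_edge (del_verts H X) (y i)) ->
  (forall i j, i != j -> vertex_disjoint (x i) (x j)) ->
  (forall i j, i != j -> vertex_disjoint (y i) (y j)) ->
  (forall i j, vertex_disjoint (x i) (y j)) ->
  exists P : 'I_s -> seq T,
    [/\ forall i, squared_tight_path (del_verts H X) (P i),
        forall i, path_from_to (P i) (x i) (y i),
        forall i j, i != j -> vertex_disjoint (P i) (P j),
        #|family_verts P|%:R <= Num.sqrt psi * n%:R
      & family_verts P :&: X = set0].
Proof.
move=> alpha alpha0; have [K [n1 conn]] := connect_avoiding alpha0.
pose k : R := (K + 7)%:R; have k0 : 0 < k by rewrite ltr0n addnS.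
have k7 : 7 <= k by rewrite ler_nat leq_addl.
(* The first bound keeps every obstacle below [alpha * n], the second turns
   [k * psi] into at most [sqrt psi]. *)
exists (Num.min (alpha / k) (k^-1 ^+ 2)); split.
  by rewrite lt_min divr_gt0 // exprn_gt0 // invr_gt0.
move=> psi psi0; rewrite le_min => /andP[psi_alpha psi_k].
exists (2 * n1 + 2)%N => n n_large T H nH codeg X XH X_small s s_small x y xe ye xx yy xy.
have n0 : 0 <= n%:R :> R by [].
have k_alpha : k * psi <= alpha by rewrite mulrC -ler_pdivlMr.
have sqrt_k : Num.sqrt psi <= k^-1.
  apply: le_trans (ler_wsqrtr psi_k) _.
  by rewrite sqrtr_sqr ger0_norm // invr_ge0 ltW.
have sqrt_psi : k * Num.sqrt psi <= 1 by rewrite mulrC -ler_pdivlMr // mul1r.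
have sq : Num.sqrt psi * Num.sqrt psi = psi by rewrite -expr2 sqr_sqrtr // ltW.
have k_psi : k * psi <= Num.sqrt psi.
  by rewrite -{1}sq mulrA -[leRHS]mul1r ler_wpM2r // sqrtr_ge0.
have k_half : 2 * (k * psi) <= 1.
  have : Num.sqrt psi <= 7^-1 by apply: le_trans sqrt_k _; rewrite lef_pV2 ?posrE.
  by move: k_psi; lra.
pose D i : {set T} := [set z in x i] :|: [set z in y i].
pose good i p := [/\ squared_tight_path (del_verts H X) p, path_from_to p (x i) (y i)
   & forall j, i != j -> [disjoint p & D j]].
have cardD i : (#|D i| <= 6)%N.
  rewrite (leq_trans (leq_card_setU _ _)) // (leq_add (m1 := _) (n1 := 3) (n2 := 3)) //.
    by rewrite cardsE (leq_trans (card_size _)) // size_tuple.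
  by rewrite cardsE (leq_trans (card_size _)) // size_tuple.
have DD i j : i != j -> [disjoint D i & D j].
  move=> ij; have ji : j != i by rewrite eq_sym.
  rewrite disjoint_subset; apply/subsetP => z; rewrite !inE.
  by case/orP => zt; rewrite negb_or ?(disjointFr (xx _ _ ij) zt) ?(disjointFr (xy i j) zt)
    ?(disjointFr (yy _ _ ij) zt) ?(disjointFl (xy j i) zt).
have ext i (U : {set T}) : (#|U| <= s * K)%N -> [disjoint U & D i] ->
    exists p, [/\ good i p, (size p <= K)%N & [disjoint p & U]].
  move=> U_small UD; pose Y := X :|: (U :|: \bigcup_(j | j != i) D j).
  have Y_small : (#|Y| <= #|X| + s * (K + 6))%N.
    rewrite (leq_trans (leq_card_setU _ _)) // leq_add2l mulnDr.
    rewrite (leq_trans (leq_card_setU _ _)) // leq_add //.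
    apply: (@leq_trans (\sum_(j < s) 6)); last by rewrite sum_nat_const card_ord.
    rewrite [leqRHS](bigID (fun j => j != i)) /= (leq_trans _ (leq_addr _ _)) //.
    elim/big_rec2: _ => [|j m A ji le]; first by rewrite cards0.
    by rewrite (leq_trans (leq_card_setU _ _)) // leq_add.
  have Y_real : #|Y|%:R <= k * psi * n%:R.
    have : #|Y|%:R <= #|X|%:R + s%:R * (K%:R + 6) :> R.
      by rewrite -natrD -natrM -natrD ler_nat.
    have := ler_wpM2r (ler0n R (K + 6)) s_small; rewrite natrD /k natrD.
    by move: X_small; lra.
  have in_V (t : 3.-tuple T) : triple_edge (del_verts H X) t -> {subset t <= D i} ->
      triple_edge (del_verts H Y) t.
    move=> te tD; apply: (triple_edge_delS te) => z zt.
    have [a [b [c tE]]] := tuple3E t; have [_ _ /(_ z zt)] := triple_edgeE tE te.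
    rewrite !inE => /andP[zX ->]; rewrite andbT !negb_or zX /=.
    rewrite (disjointFl UD (tD z zt)) /=; apply/bigcupP => -[j ji zj].
    by have := disjointFl (DD j i ji) (tD z zt); rewrite zj.
  have xi : triple_edge (del_verts H Y) (x i) by apply: in_V => // z zx; rewrite !inE zx.
  have yi : triple_edge (del_verts H Y) (y i) by apply: in_V => // z zy; rewrite !inE zy orbT.
  have [||||p [p1 p2 p3]] := conn T H Y _ _ _ _ (x i) (y i) xi yi (xy i i); rewrite ?nH //.
  - by apply: le_trans Y_real _; rewrite ler_wpM2r.
  - rewrite -(ler_nat R) natrM; have := ler_wpM2r n0 k_half; rewrite mul1r.
    by move: Y_real; lra.
  exists p; split=> //.
    split=> //; first by apply: squared_tight_pathS p1; apply: subsetUl.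
    move=> j ij; rewrite disjoint_subset; apply/subsetP => z zp.
    have [_ sub_p _] := p1; have := sub_p z zp; rewrite !inE !negb_or => /andP[/and3P[_ _ nD] _].
    by rewrite -negb_or; apply: contra nD => zD; apply/bigcupP; exists j; rewrite ?inE 1?eq_sym.
  rewrite disjoint_subset; apply/subsetP => z zp.
  by have [_ sub_p _] := p1; have := sub_p z zp; rewrite !inE !negb_or => /andP[/and3P[]].
have goodD i j p : good i p -> i != j -> [disjoint p & D j] by case=> _ _; apply.
have [P [goodP disP]] := greedy_disjoint ext goodD.
exists P; split.
- by move=> i; have [[]] := goodP i.
- by move=> i; have [[]] := goodP i.
- exact: disP.
- have : (#|family_verts P| <= s * K)%N.
    apply: (@leq_trans (\sum_(j < s) K)); last by rewrite sum_nat_const card_ord.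
    rewrite /family_verts; elim/big_rec2: _ => [|j m A ji le]; first by rewrite cards0.
    rewrite (leq_trans (leq_card_setU _ _)) // leq_add // cardsE.
    by apply: leq_trans (card_size _) (goodP j).2.
  rewrite -(ler_nat R) natrM => /le_trans; apply.
  apply: (@le_trans _ _ (k * psi * n%:R)); last by rewrite ler_wpM2r.
  rewrite -mulrA mulrC; apply: ler_pM => //; last by rewrite ler_nat leq_addr.
- apply/setP => z; rewrite !inE; apply/negP => /andP[/bigcupP[i _]]; rewrite inE => zP zX.
  have [[[_ sub_p _] _ _] _] := goodP i.
  by have := sub_p z zP; rewrite !inE zX.
Qed.
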